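(* Let $d>0$ be a fixed integer. As $b\to\infty$ through the integers $b>d$, the quantity $I(b,d,2)-b\log(b)$ has an asymptotic expansion to all orders in inverse powers of $b$. The start of this expansion is $$I(b,d,2)=b\log(b)+\frac{a_1(d)}{b^3}+\frac{a_2(d)}{b^4}+\frac{a_3(d)}{b^5}+\frac{a_4(d)}{b^6}+\frac{a_5(d)}{b^7}+O(b^{-8}),$$ with (implicit constant depending on $d$): \begin{align*} a_1(d)={}&(d+\tfrac12)d^{-2},\\ a_2(d)={}&-\frac{d+\frac12}{d^2(d+1)},\\ a_3(d)={}&(d+\tfrac12)\zeta(2)-\frac{30d^3+70d^2+47d+10}{12d^3(d+1)^2},\\ a_4(d)={}&-(2d+1)d\,\zeta(3)+(2d+1)\zeta(2)\\ &-\frac{12d^6-60d^5-258d^4-342d^3-212d^2-61d-6}{12d^4(d+1)^3},\\ a_5(d)={}&3(d+\tfrac12)d^2\zeta(4)-(d+\tfrac12)(6d+1)\zeta(3)\\ &-\frac{60d^7+240d^6+440d^5+561d^4+465d^3+219d^2+54d+6}{12d^5(d+1)^3}. \end{align*}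
   Context: For integers $b\ge 2$ and $0\le d<b$, $I(b,d,2)=\sum \frac1m$, where the sum runs over all integers $m>0$ whose base-$b$ representation (without leading zeros) contains exactly two occurrences of the digit $d$ (this series converges). $\zeta$ is the Riemann zeta function. A function $f$ of the integer $b$ has an asymptotic expansion to all orders in inverse powers of $b$ if there are coefficients $a_n$ independent of $b$ (but depending on $d$) such that for every $N$, $f(b)=\sum_{n\le N}a_nb^{-n}+O(b^{-N-1})$ as $b\to\infty$. *)

(* Defs.v *)
From Stdlib Require Import Reals Lra Lia Arith.
From Coquelicot Require Import Coquelicot.
From Stdlib Require Import List.

Open Scope R_scope.

(* Base-b digits of m, least significant first, without leading zeros (so
   digits b 0 = nil).  For b >= 2 the fuel m suffices, see digits_spec. *)
Fixpoint digits_fuel (fuel b m : nat) : list nat :=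
  match fuel with
  | O => nil
  | S fuel' =>
      if Nat.eqb m 0 then nil else (m mod b)%nat :: digits_fuel fuel' b (m / b)
  end.

Definition digits (b m : nat) : list nat := digits_fuel m b m.

Definition of_digits (b : nat) (l : list nat) : nat :=
  fold_right (fun a v => (a + b * v)%nat) 0%nat l.

Lemma digits_spec (b m : nat) : (2 <= b)%nat -> (0 < m)%nat ->
  of_digits b (digits b m) = m /\
  Forall (fun a => (a < b)%nat) (digits b m) /\
  last (digits b m) 0%nat <> 0%nat.
Proof.
intros Hb; unfold digits.
enough (H : forall f m, (m <= f)%nat -> (0 < m)%nat ->
  of_digits b (digits_fuel f b m) = m /\
  Forall (fun a => (a < b)%nat) (digits_fuel f b m) /\
  last (digits_fuel f b m) 0%nat <> 0%nat) by (apply H; lia).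
clear m; induction f as [|f IH]; intros m Hf Hm; [lia|].
cbn [digits_fuel].
destruct (Nat.eqb_spec m 0) as [E|_]; [lia|].
pose proof (Nat.div_mod_eq m b) as E.
pose proof (Nat.mod_upper_bound m b ltac:(lia)) as Hlt.
assert (Hq : (m / b < m)%nat) by (apply Nat.div_lt; lia).
destruct (Nat.eq_dec (m / b) 0) as [Z|Z].
- rewrite Z in *.
  replace (digits_fuel f b 0) with (@nil nat) by (destruct f; reflexivity).
  cbn; repeat split; [lia | now repeat constructor | lia].
- destruct (IH (m / b)%nat ltac:(lia) ltac:(lia)) as (IH1 & IH2 & IH3).
  split; [|split].
  + change ((m mod b + b * of_digits b (digits_fuel f b (m / b)))%nat = m).
    rewrite IH1; lia.
  + now constructor.
  + destruct (digits_fuel f b (m / b)); [now elim IH3 | exact IH3].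
Qed.

(* The sum of 1/m over the m > 0 whose base-b representation contains exactly
   k occurrences of the digit d.  [Series] is total (0 if the partial sums tend
   to infinity), but for 2 <= b and d < b the series converges. *)
Definition digit_harmonic_sum (b d k : nat) : R :=
  Series (fun m =>
    if andb (Nat.ltb 0 m) (Nat.eqb (count_occ Nat.eq_dec (digits b m) d) k)
    then / INR m else 0).

(* The Riemann zeta function at the integers s >= 2. *)
Definition zeta (s : nat) : R := Series (fun n => / INR (S n) ^ s).

Definition bigO (f g : nat -> R) : Prop :=
  exists C : R, eventually (fun b => Rabs (f b) <= C * Rabs (g b)).

Definition has_asymptotic_expansion (f : nat -> R) : Prop :=
  exists a : nat -> R, forall N : nat,
    bigO (fun b => f b - sum_n (fun n => a n / INR b ^ n) N)
         (fun b => / INR b ^ (N + 1)).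

Definition a1 (d : R) : R := (d + 1/2) / d^2.

Definition a2 (d : R) : R := - ((d + 1/2) / (d^2 * (d + 1))).

Definition a3 (d : R) : R :=
  (d + 1/2) * zeta 2
  - (30 * d^3 + 70 * d^2 + 47 * d + 10) / (12 * d^3 * (d + 1)^2).

Definition a4 (d : R) : R :=
  - (2 * d + 1) * d * zeta 3 + (2 * d + 1) * zeta 2
  - (12 * d^6 - 60 * d^5 - 258 * d^4 - 342 * d^3 - 212 * d^2 - 61 * d - 6)
    / (12 * d^4 * (d + 1)^3).

Definition a5 (d : R) : R :=
  3 * (d + 1/2) * d^2 * zeta 4 - (d + 1/2) * (6 * d + 1) * zeta 3
  - (60 * d^7 + 240 * d^6 + 440 * d^5 + 561 * d^4 + 465 * d^3 + 219 * d^2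
     + 54 * d + 6)
    / (12 * d^5 * (d + 1)^3).

(* Main.v *)
Require Import Defs.
From Stdlib Require Import Reals Lra Lia Arith List.
From Coquelicot Require Import Coquelicot.
Import ListNotations.
Open Scope R_scope.

(** Let [mu_k] be the sum, over all strings [w] of base-[b] digits with exactly
    [k] digits [d], of the point masses [b ^ -|w|] at [w / b ^ |w|] in [[0, 1]].
    Sorting the numbers by their leading digit [n] gives
    [I(b, d, 2) = sum_(n <> d) mu_2 (1 / (n + x)) + mu_1 (1 / (d + x))], the sum
    being over [0 < n < b] ([digit_harmonic_sum_mu]). Each [mu_k] has mass [b]
    and is close to [b dx]. For [b dx] the integrals of the [1 / (n + x)]
    telescope to exactly [b log b], so only the signed measures
    [nu_k = mu_k - b dx], of mass zero, matter.

    Splitting off the leading digit of [w] shows that [mu_k] and [b dx] are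
    self-similar ([mu_step], [nu_step]). For the integrals
    [H_k n = nu_k (1 / (n + x))] this reads
    [H_k n = sum_(a < b) H_k (n b + a) + (H_(k-1) - H_k) (n b + d)] for [k > 0].
    Summing over all [n > 0] makes the double sums cancel, and with
    [K = H_1 - H_2] there results
    [I - b log b = sum_(n > 0) K (n b + d) + sum_(a < b) K (d b + a)
      + (H_0 - 2 H_1 + H_2) (d b + d)] ([exact_formula]).
    Every argument is now at least [b], so that [1 / (n + x)] can be expanded in
    powers of [x / n], or of [(d + x) / (n b)], with a uniform remainder. This
    leaves three kinds of quantities: zeta values, from the first sum; the sums of
    [v ^ -s] over [d b <= v < (d + 1) b]; and the moments of [nu_k].

    - The sums of [v ^ -s] are expanded through inverse factorials: the sum of
      [1 / (v (v + 1) ... (v + p - 1))] telescopes, and replacing a factor [1 / v]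
      by [1 / (v + p)] costs a term of higher degree ([expandable_inv_sum]).
    - Self-similarity gives a linear recurrence for the moments with coefficients
      polynomial in [b] ([nu_pow_rec]). By induction on [k] and on the degree,
      the first moment of [nu_k] is [O (b ^ -(2 k + 1))], the higher ones are
      [O (b ^ -(2 k + 2))], and all have expansions ([expandable_moments]).

    Expansions are handled through the relation [expansion l f], where [l] is the
    list of the first coefficients of [f] in powers of [1 / b]; sums, products and
    quotients of functions correspond to operations on lists. Existence to all
    orders follows by closure under these operations ([expandable_deviation]).
    Thanks to the rapid decay of the moments, the coefficients up to [b ^ -7] need
    only a few moments of low degree, and they are found by calculating with the
    lists ([expansion_main_part]). *)
(** * Finite sums *)

(** The sum of [f i] over [0 <= i < n]. *)
Fixpoint rsum (n : nat) (f : nat -> R) : R :=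
  match n with O => 0 | S n' => rsum n' f + f n' end.

Lemma rsum_ext n f g :
  (forall i, (i < n)%nat -> f i = g i) -> rsum n f = rsum n g.
Proof.
induction n as [|n IH]; intros H; cbn; [easy|].
rewrite IH, H; [easy | lia | intros; apply H; lia].
Qed.

Lemma rsum_plus n f g : rsum n (fun i => f i + g i) = rsum n f + rsum n g.
Proof. induction n as [|n IH]; cbn; [lra|]. rewrite IH; lra. Qed.

Lemma rsum_scal n c f : rsum n (fun i => c * f i) = c * rsum n f.
Proof. induction n as [|n IH]; cbn; [lra|]. rewrite IH; lra. Qed.

Lemma rsum_minus n f g : rsum n (fun i => f i - g i) = rsum n f - rsum n g.
Proof. induction n as [|n IH]; cbn; [lra|]. rewrite IH; lra. Qed.

Lemma rsum_const n c : rsum n (fun _ => c) = INR n * c.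
Proof. induction n as [|n IH]; [cbn; lra|]. rewrite S_INR; cbn [rsum]; rewrite IH;
  lra. Qed.

Lemma rsum_le n f g :
  (forall i, (i < n)%nat -> f i <= g i) -> rsum n f <= rsum n g.
Proof.
induction n as [|n IH]; intros H; cbn; [lra|].
apply Rplus_le_compat; [apply IH; intros; apply H; lia | apply H; lia].
Qed.

Lemma rsum_abs n f : Rabs (rsum n f) <= rsum n (fun i => Rabs (f i)).
Proof.
induction n as [|n IH]; cbn; [rewrite Rabs_R0; lra|].
eapply Rle_trans; [apply Rabs_triang|lra].
Qed.

Lemma rsum_add n m f :
  rsum (n + m) f = rsum n f + rsum m (fun i => f (n + i)%nat).
Proof.
induction m as [|m IH]; [rewrite Nat.add_0_r; cbn; lra|].
rewrite Nat.add_succ_r; cbn; rewrite IH; lra.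
Qed.

Lemma rsum_S_l n f : rsum (S n) f = f 0%nat + rsum n (fun i => f (S i)).
Proof. change (S n) with (1 + n)%nat; rewrite rsum_add; cbn; lra. Qed.

Lemma rsum_mul n b f :
  rsum (n * b) f = rsum n (fun i => rsum b (fun a => f (i * b + a)%nat)).
Proof.
induction n as [|n IH]; [easy|].
replace (S n * b)%nat with (n * b + b)%nat by lia.
rewrite rsum_add, IH; easy.
Qed.

Lemma rsum_tele n f : rsum n (fun i => f (S i) - f i) = f n - f 0%nat.
Proof. induction n as [|n IH]; cbn; [lra|]. rewrite IH; lra. Qed.

Lemma rsum_single n d f g : (d < n)%nat ->
  rsum n (fun a => if Nat.eqb a d then g a else f a) = rsum n f + (g d - f d).
Proof.
intros Hd; replace n with (d + S (n - S d))%nat by lia.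
rewrite !rsum_add, !rsum_S_l, !Nat.add_0_r, Nat.eqb_refl.
rewrite (rsum_ext d _ f) by (intros i Hi; destruct (Nat.eqb_spec i d); [lia|easy]).
rewrite (rsum_ext (n - S d) _ (fun i => f (d + S i)%nat))
  by (intros i Hi; destruct (Nat.eqb_spec (d + S i) d); [lia|easy]).
lra.
Qed.

Lemma sum_n_rsum f n : sum_n f n = rsum (S n) f.
Proof.
induction n as [|n IH]; [rewrite sum_O; cbn; lra|].
rewrite sum_Sn, IH; easy.
Qed.

Lemma sum_f_R0_rsum f n : sum_f_R0 f n = rsum (S n) f.
Proof. induction n as [|n IH]; cbn; [lra|]. rewrite IH; easy. Qed.

(** * The measures counting occurrences of a digit *)

(** The function of the remaining digits obtained from [f] by prepending the
    digit [a], and the sum of these functions over all digits other than [d]. *)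
Definition digit_branch (b a : nat) (f : R -> R) (x : R) : R :=
  f ((INR a + x) / INR b) / INR b.

Definition other_digits (b d : nat) (f : R -> R) (x : R) : R :=
  rsum b (fun a => if Nat.eqb a d then 0 else f ((INR a + x) / INR b) / INR b).

(** [string_sum b d l k f] is the sum of [f (w / b ^ l) / b ^ l] over the strings [w] of
    [l] digits in base [b] in which the digit [d] occurs exactly [k] times; the
    recursion peels off the leading digit of the string. Strings may begin with
    zeros. *)
Fixpoint string_sum (b d l k : nat) (f : R -> R) : R :=
  match l with
  | O => if Nat.eqb k 0 then f 0 else 0
  | S l' => string_sum b d l' k (other_digits b d f)
            + match k with
              | O => 0
              | S k' => string_sum b d l' k' (digit_branch b d f)
              end
  end.

Definition bounded01 (f : R -> R) : Prop :=
  exists M, forall x, 0 <= x <= 1 -> Rabs (f x) <= M.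

(** Integration against the measure [mu_k], the sum over all strings [w] with
    exactly [k] digits [d] of the point masses [b ^ - |w|] at [w / b ^ |w|]. *)
Definition mu (b d k : nat) (f : R -> R) : R := Series (fun l => string_sum b d l k f).

Lemma ex_series_nonneg_bounded (a : nat -> R) M :
  (forall n, 0 <= a n) -> (forall n, rsum n a <= M) -> ex_series a.
Proof.
intros Ha HM.
destruct (ex_finite_lim_seq_incr (sum_n a) M) as [l Hl].
- intros n; rewrite sum_Sn; unfold plus; cbn; specialize (Ha (S n)); lra.
- intros n; rewrite sum_n_rsum; apply HM.
- now exists l.
Qed.

Lemma bounded01_lin c f g : bounded01 f -> bounded01 g ->
  bounded01 (fun x => c * f x + g x).
Proof.
intros [M HM] [M' HM']; exists (Rabs c * M + M'); intros x Hx.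
eapply Rle_trans; [apply Rabs_triang|]; rewrite Rabs_mult.
apply Rplus_le_compat; [apply Rmult_le_compat_l; [apply Rabs_pos|]|]; auto.
Qed.

Lemma bounded01_const c : bounded01 (fun _ => c).
Proof. exists (Rabs c); intros; lra. Qed.

Lemma bounded01_ext f g : (forall x, 0 <= x <= 1 -> f x = g x) ->
  bounded01 f -> bounded01 g.
Proof. intros H [M HM]; exists M; intros x Hx; rewrite <- H; auto. Qed.

Lemma bounded01_rsum n (f : nat -> R -> R) :
  (forall i, (i < n)%nat -> bounded01 (f i)) ->
  bounded01 (fun x => rsum n (fun i => f i x)).
Proof.
induction n as [|n IH]; intros H; cbn; [apply bounded01_const|].
apply bounded01_ext with (fun x => 1 * f n x + rsum n (fun i => f i x));
  [intros; lra|].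
apply bounded01_lin; [|apply IH; intros]; apply H; lia.
Qed.

Lemma b_pos b : (2 <= b)%nat -> 0 < INR b.
Proof. intros; apply lt_0_INR; lia. Qed.

Section Measures.

Context (b d : nat) (Hb : (2 <= b)%nat) (Hd : (d < b)%nat).

Lemma branch_in01 a x : (a < b)%nat -> 0 <= x <= 1 ->
  0 <= (INR a + x) / INR b <= 1.
Proof.
intros Ha Hx; pose proof (b_pos b Hb); pose proof (pos_INR a).
assert (INR a + 1 <= INR b) by (rewrite <- S_INR; apply le_INR; lia).
split; [apply Rdiv_le_0_compat; lra|].
apply Rle_div_l; lra.
Qed.

Lemma string_sum_le l : forall k f g, (forall x, 0 <= x <= 1 -> f x <= g x) ->
  string_sum b d l k f <= string_sum b d l k g.
Proof.
pose proof (b_pos b Hb) as Hp; assert (Hi : 0 <= / INR b)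
  by (left; now apply Rinv_0_lt_compat).
induction l as [|l IH]; intros k f g H; cbn [string_sum].
- destruct (Nat.eqb k 0); [apply H|]; lra.
- apply Rplus_le_compat.
  + apply IH; intros x Hx; apply rsum_le; intros a Ha.
    destruct (Nat.eqb a d); [lra|].
    apply Rmult_le_compat_r; [easy|]; now apply H, branch_in01.
  + destruct k as [|k]; [lra|].
    apply IH; intros x Hx.
    apply Rmult_le_compat_r; [easy|]; now apply H, branch_in01.
Qed.

Lemma string_sum_ext l k f g : (forall x, 0 <= x <= 1 -> f x = g x) ->
  string_sum b d l k f = string_sum b d l k g.
Proof. intros H; apply Rle_antisym; apply string_sum_le; intros x Hx; rewrite (H x Hx);
  lra. Qed.

Lemma string_sum_lin l : forall k c f g,
  string_sum b d l k (fun x => c * f x + g x) = c * string_sum b d l k f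
    + string_sum b d l k g.
Proof.
induction l as [|l IH]; intros k c f g; cbn [string_sum].
- destruct (Nat.eqb k 0); lra.
- rewrite (string_sum_ext l k _ (fun x => c * other_digits b d f x
  + other_digits b d g x)).
  2:{ intros x _; unfold other_digits; rewrite <- rsum_scal, <- rsum_plus.
      apply rsum_ext; intros a _; destruct (Nat.eqb a d); lra. }
  rewrite IH; destruct k as [|k]; [lra|].
  rewrite (string_sum_ext l k _ (fun x => c * digit_branch b d f x
    + digit_branch b d g x))
    by (intros x _; unfold digit_branch; lra).
  rewrite IH; lra.
Qed.

Lemma string_sum_0 l k : string_sum b d l k (fun _ => 0) = 0.
Proof.
pose proof (string_sum_lin l k 1 (fun _ => 0) (fun _ => 0)) as H; cbn beta in H.
rewrite (string_sum_ext l k _ (fun _ => 0)) in H by (intros; lra); lra.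
Qed.

Lemma string_sum_scal l k c f : string_sum b d l k (fun x => c * f x)
  = c * string_sum b d l k f.
Proof.
rewrite (string_sum_ext l k _ (fun x => c * f x + 0)) by (intros; lra).
rewrite string_sum_lin, string_sum_0; lra.
Qed.

Lemma string_sum_rsum l k n (f : nat -> R -> R) :
  string_sum b d l k (fun x => rsum n (fun i => f i x))
    = rsum n (fun i => string_sum b d l k (f i)).
Proof.
induction n as [|n IH]; cbn [rsum]; [apply string_sum_0|].
rewrite <- IH, (string_sum_ext l k _ (fun x => 1 * f n x + rsum n (fun i => f i x)))
  by (intros; lra).
rewrite string_sum_lin; lra.
Qed.

Lemma string_sum_abs_le l k f M : (forall x, 0 <= x <= 1 -> Rabs (f x) <= M) ->
  Rabs (string_sum b d l k f) <= M * string_sum b d l k (fun _ => 1).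
Proof.
intros H; rewrite <- string_sum_scal; apply Rabs_le; split.
- rewrite <- (Rmult_1_l (string_sum b d l k (fun _ => M * 1))), Ropp_mult_distr_l,
  <- string_sum_scal.
  apply string_sum_le; intros x Hx; specialize (H x Hx); apply Rabs_le_between in H;
    lra.
- apply string_sum_le; intros x Hx; specialize (H x Hx); apply Rabs_le_between in H;
  lra.
Qed.

Lemma string_sum_mass_pos l k : 0 <= string_sum b d l k (fun _ => 1).
Proof. rewrite <- (string_sum_0 l k); apply string_sum_le; intros; lra. Qed.

Lemma string_sum_mass_S l k : string_sum b d (S l) k (fun _ => 1)
  = (INR b - 1) / INR b * string_sum b d l k (fun _ => 1)
    + match k with O => 0 | S k' => / INR b * string_sum b d l k' (fun _ => 1) end.
Proof.
pose proof (b_pos b Hb); cbn [string_sum]; rewrite <- string_sum_scal.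
f_equal.
- apply string_sum_ext; intros x _; unfold other_digits.
  rewrite rsum_single, rsum_const by easy; field; lra.
- destruct k as [|k]; [easy|]; rewrite <- string_sum_scal.
  apply string_sum_ext; intros; unfold digit_branch; field; lra.
Qed.

(** Each of these measures has total mass [b], whatever [k] is; this is an upper
    bound for the partial sums. *)
Lemma string_sum_mass_partial k L : rsum L (fun l => string_sum b d l k (fun _ => 1))
  <= INR b.
Proof.
pose proof (b_pos b Hb).
assert (H2 : 2 <= INR b) by (change 2 with (INR 2); now apply le_INR).
induction k as [|k IHk] in L |- *; induction L as [|L IHL]; try (cbn; lra);
rewrite rsum_S_l.
- rewrite (rsum_ext L _ (fun l =>
  (INR b - 1) / INR b * string_sum b d l 0 (fun _ => 1)))
    by (intros; rewrite string_sum_mass_S; lra).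
  rewrite rsum_scal; cbn [string_sum Nat.eqb].
  apply Rle_trans with (1 + (INR b - 1) / INR b * INR b); [|right; field; lra].
  apply Rplus_le_compat_l, Rmult_le_compat_l; [|easy].
  apply Rdiv_le_0_compat; lra.
- rewrite (rsum_ext L _ (fun l =>
  (INR b - 1) / INR b * string_sum b d l (S k) (fun _ => 1)
      + / INR b * string_sum b d l k (fun _ => 1)))
        by (intros; apply string_sum_mass_S).
  rewrite rsum_plus, !rsum_scal; cbn [string_sum Nat.eqb].
  apply Rle_trans with (0 + ((INR b - 1) / INR b * INR b + / INR b * INR b));
    [|right; field; lra].
  apply Rplus_le_compat_l, Rplus_le_compat; apply Rmult_le_compat_l; try easy.
  + apply Rdiv_le_0_compat; lra.
  + left; now apply Rinv_0_lt_compat.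
Qed.

Lemma ex_mass k : ex_series (fun l => string_sum b d l k (fun _ => 1)).
Proof.
apply ex_series_nonneg_bounded with (INR b).
- intros; apply string_sum_mass_pos.
- intros; apply string_sum_mass_partial.
Qed.

Lemma mass_le k : Series (fun l => string_sum b d l k (fun _ => 1)) <= INR b.
Proof.
destruct (ex_mass k) as [s Hs]; rewrite (is_series_unique _ _ Hs).
apply (is_lim_seq_le (sum_n (fun l => string_sum b d l k (fun _ => 1))) (fun _ =>
  INR b) s (INR b)).
- intros n; rewrite sum_n_rsum; apply string_sum_mass_partial.
- exact Hs.
- apply is_lim_seq_const.
Qed.

Lemma ex_mu k f : bounded01 f -> ex_series (fun l => string_sum b d l k f).
Proof.
intros [M HM].
apply (@ex_series_le R_AbsRing R_CompleteNormedModule _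
  (fun l => M * string_sum b d l k (fun _ => 1))).
- intros l; apply string_sum_abs_le, HM.
- apply (@ex_series_scal R_AbsRing R_NormedModule M), ex_mass.
Qed.

Lemma mu_ext k f g : (forall x, 0 <= x <= 1 -> f x = g x) ->
  mu b d k f = mu b d k g.
Proof. intros H; apply Series_ext; intros; now apply string_sum_ext. Qed.

Lemma mu_lin k c f g : bounded01 f -> bounded01 g ->
  mu b d k (fun x => c * f x + g x) = c * mu b d k f + mu b d k g.
Proof.
intros Hf Hg; unfold mu.
rewrite (Series_ext _ (fun l => c * string_sum b d l k f + string_sum b d l k g))
  by (intros; apply string_sum_lin).
rewrite Series_plus; [|apply (@ex_series_scal R_AbsRing R_NormedModule c)|];
  try now apply ex_mu.
now rewrite Series_scal_l.
Qed.

Lemma mu_abs_le k f M : (forall x, 0 <= x <= 1 -> Rabs (f x) <= M) ->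
  Rabs (mu b d k f) <= M * INR b.
Proof.
intros H; unfold mu.
assert (HM : 0 <= M) by (specialize (H 0 ltac:(lra)); pose proof (Rabs_pos (f 0)); lra).
assert (Heq : ex_series (fun l => M * string_sum b d l k (fun _ => 1)))
  by apply (@ex_series_scal R_AbsRing R_NormedModule M), ex_mass.
eapply Rle_trans; [apply Series_Rabs|].
- apply (@ex_series_le R_AbsRing R_CompleteNormedModule _
    (fun l => M * string_sum b d l k (fun _ => 1))); [|exact Heq].
  intros l; cbv [norm]; cbn; unfold abs; cbn; rewrite Rabs_Rabsolu;
    now apply string_sum_abs_le.
- eapply Rle_trans; [apply Series_le with (2 := Heq)|].
  + intros l; split; [apply Rabs_pos | now apply string_sum_abs_le].
  + rewrite Series_scal_l; apply Rmult_le_compat_l; [easy | apply mass_le].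
Qed.

Lemma bounded01_branch a f : (a < b)%nat -> bounded01 f ->
  bounded01 (digit_branch b a f).
Proof.
intros Ha [M HM]; exists (M * / INR b); intros x Hx; unfold digit_branch.
pose proof (Rinv_0_lt_compat _ (b_pos b Hb)).
unfold Rdiv; rewrite Rabs_mult, (Rabs_pos_eq (/ INR b)) by lra.
apply Rmult_le_compat_r; [lra|]; now apply HM, branch_in01.
Qed.

Lemma mu_rsum k n (f : nat -> R -> R) :
  (forall i, (i < n)%nat -> bounded01 (f i)) ->
  mu b d k (fun x => rsum n (fun i => f i x)) = rsum n (fun i => mu b d k (f i)).
Proof.
induction n as [|n IH]; intros H; cbn [rsum].
- unfold mu; rewrite (Series_ext _ (fun l => 0 * 0)), Series_scal_l; [lra|].
  intros; rewrite string_sum_0; lra.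
- rewrite <- IH by (intros; apply H; lia).
  rewrite (mu_ext k _ (fun x => 1 * f n x + rsum n (fun i => f i x)))
    by (intros; lra).
  rewrite mu_lin; [lra | apply H; lia | apply bounded01_rsum; intros; apply H; lia].
Qed.

Lemma other_digits_branches f x : other_digits b d f x
  = rsum b (fun a => digit_branch b a f x) - digit_branch b d f x.
Proof.
unfold other_digits; rewrite rsum_single by easy; unfold digit_branch; lra.
Qed.

Lemma mu_other_digits k f : bounded01 f ->
  mu b d k (other_digits b d f)
  = rsum b (fun a => mu b d k (digit_branch b a f)) - mu b d k (digit_branch b d f).
Proof.
intros Hf.
assert (Hr : forall i, (i < b)%nat -> bounded01 (digit_branch b i f))
  by (intros; now apply bounded01_branch).
rewrite (mu_ext k _ (fun x => -1 * digit_branch b d f x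
  + rsum b (fun a => digit_branch b a f x)))
  by (intros; rewrite other_digits_branches; ring).
rewrite (mu_lin k (-1) (digit_branch b d f)
  (fun x => rsum b (fun a => digit_branch b a f x))) by auto using bounded01_rsum.
rewrite (mu_rsum k b (fun a => digit_branch b a f)) by easy; lra.
Qed.

(** The self-similarity of the measures, obtained by peeling off the leading
    digit. *)
Lemma mu_step k f : bounded01 f ->
  mu b d k f = (if Nat.eqb k 0 then f 0 else 0)
    + rsum b (fun a => mu b d k (digit_branch b a f)) - mu b d k (digit_branch b d f)
    + match k with O => 0 | S k' => mu b d k' (digit_branch b d f) end.
Proof.
intros Hf; unfold mu at 1; rewrite Series_incr_1 by now apply ex_mu.
assert (Ho : bounded01 (other_digits b d f)).
{ apply bounded01_ext with (fun x => -1 * digit_branch b d f x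
    + rsum b (fun a => digit_branch b a f x));
    [intros; rewrite other_digits_branches; ring|].
  apply bounded01_lin; [now apply bounded01_branch|].
  apply bounded01_rsum; intros; now apply bounded01_branch. }
cbn [string_sum]; pose proof (mu_other_digits k f Hf) as Heq.
destruct k as [|k]; cbn [Nat.eqb].
- rewrite (Series_ext _ (fun l => string_sum b d l 0 (other_digits b d f)))
  by (intros; lra).
  fold (mu b d 0 (other_digits b d f)); lra.
- rewrite Series_plus; [|now apply ex_mu | now apply ex_mu, bounded01_branch].
  fold (mu b d (S k) (other_digits b d f)) (mu b d k (digit_branch b d f)); lra.
Qed.

Lemma mu_mass k : mu b d k (fun _ => 1) = INR b.
Proof.
pose proof (b_pos b Hb).
assert (B : bounded01 (fun _ => 1)) by apply bounded01_const.
assert (Heq : forall k' a, mu b d k' (digit_branch b a (fun _ => 1))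
  = / INR b * mu b d k' (fun _ => 1)).
{ intros k' a.
  rewrite (mu_ext k' _ (fun _ => / INR b * 1 + 0))
    by (intros; unfold digit_branch; lra).
  rewrite (mu_lin k' (/ INR b) (fun _ => 1) (fun _ => 0)) by apply bounded01_const.
  pose proof (mu_rsum k' 0 (fun _ _ => 0) ltac:(intros; lia)) as Z; cbn in Z.
  rewrite Z; lra. }
induction k as [|k IH].
- pose proof (mu_step 0 _ B) as S1; cbn [Nat.eqb] in S1.
  rewrite (rsum_ext b _ (fun _ => / INR b * mu b d 0 (fun _ => 1))), rsum_const, Heq
    in S1 by (intros; apply Heq).
  apply (Rmult_eq_reg_l (/ INR b)); [|apply Rinv_neq_0_compat; lra].
  rewrite Rinv_l by lra.
  rewrite <- Rmult_assoc, Rinv_r in S1 by lra; lra.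
- pose proof (mu_step (S k) _ B) as S1; cbn [Nat.eqb] in S1.
  rewrite (rsum_ext b _ (fun _ => / INR b * mu b d (S k) (fun _ => 1))), rsum_const,
    !Heq, IH
    in S1 by (intros; apply Heq).
  apply (Rmult_eq_reg_l (/ INR b)); [|apply Rinv_neq_0_compat; lra].
  rewrite Rinv_l in * by lra.
  rewrite <- Rmult_assoc, Rinv_r in S1 by lra; lra.
Qed.

End Measures.

(** * Numbers with a given leading digit *)

(** The kernel [x |-> 1 / (n + x)]. *)
Definition recip (n : R) (x : R) : R := / (n + x).

(** The number of occurrences of the digit [d] in [m]. *)
Definition count (b d m : nat) : nat := count_occ Nat.eq_dec (digits b m) d.

(** The summand of [digit_harmonic_sum]. *)
Definition term (b d k m : nat) : R :=
  if andb (Nat.ltb 0 m) (Nat.eqb (count b d m) k) then / INR m else 0.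

Lemma bounded01_recip n : 0 < n -> bounded01 (recip n).
Proof.
intros Hn; exists (/ n); intros x Hx; unfold recip.
rewrite Rabs_pos_eq by (left; apply Rinv_0_lt_compat; lra).
apply Rinv_le_contravar; lra.
Qed.

Lemma recip_branch b n a x : (2 <= b)%nat -> (0 < n)%nat -> 0 <= x ->
  digit_branch b a (recip (INR n)) x = recip (INR (n * b + a)) x.
Proof.
intros Hb Hn Hx; unfold digit_branch, recip; rewrite plus_INR, mult_INR.
assert (0 < INR n) by (now apply lt_0_INR).
assert (0 < INR b) by (apply lt_0_INR; lia).
pose proof (pos_INR a).
field; split; [|lra].
assert (0 < INR n * INR b) by nra; lra.
Qed.

Section Blocks.
Context (b d : nat) (Hb : (2 <= b)%nat) (Hd : (d < b)%nat).

Lemma digits_fuel_enough f : forall m, (m <= f)%nat ->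
  digits_fuel f b m = digits b m.
Proof.
unfold digits.
assert (H : forall f g m, (m <= f)%nat -> (m <= g)%nat ->
  digits_fuel f b m = digits_fuel g b m).
{ clear f; induction f as [|f IH]; intros g m Hf Hg.
  - replace m with 0%nat by lia; destruct g; reflexivity.
  - destruct g as [|g]; [replace m with 0%nat by lia; reflexivity|].
    cbn; destruct (Nat.eqb_spec m 0); [easy|].
    assert ((m / b < m)%nat) by (apply Nat.div_lt; lia).
    f_equal; apply IH; lia. }
intros m Hm; apply H; lia.
Qed.

Lemma digits_cons n a : (0 < n * b + a)%nat -> (a < b)%nat ->
  digits b (n * b + a) = a :: digits b n.
Proof.
intros Hp Ha; unfold digits at 1.
destruct (n * b + a)%nat as [|m] eqn:Heq; [lia|].
cbn [digits_fuel]; cbn [Nat.eqb]; rewrite <- Heq.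
replace ((n * b + a) mod b)%nat with a
  by (apply (Nat.mod_unique _ _ n); lia).
replace ((n * b + a) / b)%nat with n
  by (apply (Nat.div_unique _ _ _ a); lia).
f_equal; apply digits_fuel_enough; nia.
Qed.

Lemma count_cons n a : (0 < n * b + a)%nat -> (a < b)%nat ->
  count b d (n * b + a) = (count b d n + if Nat.eqb a d then 1 else 0)%nat.
Proof.
intros Hp Ha; unfold count; rewrite digits_cons by easy; cbn.
destruct (Nat.eq_dec a d), (Nat.eqb_spec a d); lia.
Qed.

(** The numbers whose base-[b] representation is that of [n] followed by [l]
    more digits, summed with the help of the strings of length [l]. *)
Lemma block_sum l : forall n k, (0 < n)%nat ->
  rsum (b ^ l) (fun x => term b d k (n * b ^ l + x))
  = if Nat.leb (count b d n) k
    then string_sum b d l (k - count b d n) (recip (INR n)) else 0.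
Proof.
induction l as [|l IH]; intros n k Hn.
- cbn [Nat.pow rsum string_sum]; replace (n * 1 + 0)%nat with n by lia; unfold term,
  recip.
  replace (0 <? n)%nat with true by (symmetry; apply Nat.ltb_lt; lia); cbn [andb].
  destruct (Nat.eqb_spec (count b d n) k), (Nat.leb_spec (count b d n) k),
    (Nat.eqb_spec (k - count b d n) 0); try lia; rewrite ?Rplus_0_r; lra.
- cbn [Nat.pow]; rewrite rsum_mul.
  rewrite (rsum_ext b _ (fun a => rsum (b ^ l)
    (fun x => term b d k ((n * b + a) * b ^ l + x))))
    by (intros a _; apply rsum_ext; intros x _; f_equal; lia).
  rewrite (rsum_ext b _ (fun a =>
    if Nat.eqb a d
    then (if Nat.leb (S (count b d n)) k
          then string_sum b d l (k - S (count b d n)) (recip (INR (n * b + a))) else 0)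
    else (if Nat.leb (count b d n) k
          then string_sum b d l (k - count b d n) (recip (INR (n * b + a))) else 0))).
  2:{ intros a Ha; rewrite IH, count_cons by nia.
      destruct (Nat.eqb a d); rewrite ?Nat.add_1_r, ?Nat.add_0_r; easy. }
  rewrite rsum_single by easy.
  destruct (Nat.leb_spec (count b d n) k) as [H|H].
  2:{ replace (S (count b d n) <=? k)%nat with false
        by (symmetry; apply Nat.leb_gt; lia).
      rewrite rsum_const; lra. }
  cbn [string_sum].
  rewrite (string_sum_ext b d Hb Hd l (k
    - count b d n) (other_digits b d (recip (INR n)))
    (fun x => -1 * recip (INR (n * b + d)) x
       + rsum b (fun a => recip (INR (n * b + a)) x))) by
    first [easy | intros x Hx; rewrite other_digits_branches by easy;
      rewrite recip_branch by (easy || lra);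
      rewrite (rsum_ext b _ (fun a => recip (INR (n * b + a)) x))
        by (intros; apply recip_branch; (easy || lra)); lra].
  rewrite (string_sum_lin b d Hb Hd l _ (-1) (recip (INR (n * b + d)))
    (fun x => rsum b (fun a => recip (INR (n * b + a)) x))) by easy.
  rewrite (string_sum_rsum b d Hb Hd l _ b (fun a => recip (INR (n * b + a)))) by easy.
  destruct (Nat.leb_spec (S (count b d n)) k) as [H'|H'].
  + replace (k - count b d n)%nat with (S (k - S (count b d n))) by lia.
    rewrite (string_sum_ext b d Hb Hd l (k
      - S (count b d n)) (digit_branch b d (recip (INR n)))
      (recip (INR (n * b + d))))
        by (easy || (intros; apply recip_branch; (easy || lra))).
    lra.
  + replace (k - count b d n)%nat with 0%nat by lia; lra.
Qed.

Lemma count_digit n : (0 < n < b)%nat ->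
  count b d n = if Nat.eqb n d then 1%nat else 0%nat.
Proof.
intros Hn; change n with (0 * b + n)%nat at 1.
rewrite count_cons by lia; easy.
Qed.

Lemma term_nonneg k m : 0 <= term b d k m.
Proof.
unfold term; destruct (Nat.ltb_spec 0 m); cbn [andb]; [|lra].
destruct (Nat.eqb _ _); [|lra].
left; now apply Rinv_0_lt_compat, lt_0_INR.
Qed.

Lemma partial_sum_pow L : (0 < d)%nat ->
  rsum (b ^ L) (term b d 2)
  = rsum L (fun l => rsum (b - 1) (fun i => string_sum b d l 2 (recip (INR (S i))))
      + (string_sum b d l 1 (recip (INR d)) - string_sum b d l 2 (recip (INR d)))).
Proof.
intros Hd0; induction L as [|L IH].
- cbn; unfold term; cbn; lra.
- cbn [Nat.pow rsum]; rewrite rsum_mul.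
  replace b with (S (b - 1)) at 1 by lia.
  rewrite rsum_S_l, <- IH.
  change (rsum (b ^ L) (fun a => term b d 2 (0 * b ^ L + a)))
    with (rsum (b ^ L) (term b d 2)).
  f_equal.
  rewrite (rsum_ext (b - 1) _ (fun i => if Nat.eqb i (d - 1)
    then string_sum b d L 1 (recip (INR (S i))) else string_sum b d L 2
      (recip (INR (S i))))).
  + rewrite rsum_single by lia; replace (S (d - 1)) with d by lia; easy.
  + intros i Hi; rewrite (block_sum L (S i) 2) by lia.
    rewrite count_digit by lia.
    destruct (Nat.eqb_spec i (d - 1)), (Nat.eqb_spec (S i) d); try lia; easy.
Qed.

(** The sum of the reciprocals, sorted by leading digit. *)
Lemma digit_harmonic_sum_mu : (0 < d)%nat ->
  digit_harmonic_sum b d 2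
  = rsum (b - 1) (fun i => mu b d 2 (recip (INR (S i))))
    + (mu b d 1 (recip (INR d)) - mu b d 2 (recip (INR d))).
Proof.
intros Hd0.
set (S0 := rsum (b - 1) (fun i => mu b d 2 (recip (INR (S i))))
    + (mu b d 1 (recip (INR d)) - mu b d 2 (recip (INR d)))).
assert (Hlim : is_lim_seq (fun L => rsum (b ^ L) (term b d 2)) S0).
{ apply is_lim_seq_incr_1.
  apply (is_lim_seq_ext (sum_n (fun l =>
    rsum (b - 1) (fun i => string_sum b d l 2 (recip (INR (S i))))
      + (string_sum b d l 1 (recip (INR d)) - string_sum b d l 2 (recip (INR d)))))).
  { intros n; rewrite sum_n_rsum; symmetry; now apply partial_sum_pow. }
  assert (Hs : forall k n, (0 < n)%nat ->
    is_series (fun l => string_sum b d l k (recip (INR n))) (mu b d k (recip (INR n)))).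
  { intros k n Hn; apply Series_correct, ex_mu; try easy.
    now apply bounded01_recip, lt_0_INR. }
  change (is_series (fun l =>
    plus (rsum (b - 1) (fun i => string_sum b d l 2 (recip (INR (S i)))))
      (plus (string_sum b d l 1 (recip (INR d)))
        (opp (string_sum b d l 2 (recip (INR d)))))) S0).
  apply (@is_series_plus R_AbsRing R_NormedModule).
  - generalize (b - 1)%nat; intros p; induction p as [|p IH]; cbn [rsum].
    + apply (is_lim_seq_ext (fun _ => 0) _ 0).
      * intros n; rewrite sum_n_rsum, rsum_const; lra.
      * apply is_lim_seq_const.
    + apply (@is_series_plus R_AbsRing R_NormedModule); [easy|].
      apply Hs; lia.
  - apply (@is_series_minus R_AbsRing R_NormedModule); now apply Hs. }
assert (Hinc : forall m n, (m <= n)%nat ->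
  rsum m (term b d 2) <= rsum n (term b d 2)).
{ intros m n Hmn; replace n with (m + (n - m))%nat by lia; rewrite rsum_add.
  assert (0 <= rsum (n - m) (fun i => term b d 2 (m + i))); [|lra].
  replace 0 with (rsum (n - m) (fun _ => 0)) by (rewrite rsum_const; lra).
  apply rsum_le; intros; apply term_nonneg. }
assert (Hle : forall L, rsum (b ^ L) (term b d 2) <= S0).
{ intros L; apply (is_lim_seq_incr_compare (fun L => rsum (b ^ L) (term b d 2)) S0);
    [easy|].
  intros n; apply Hinc, Nat.pow_le_mono_r; lia. }
assert (Hex : ex_series (term b d 2)).
{ apply ex_series_nonneg_bounded with S0; [apply term_nonneg|].
  intros n; apply Rle_trans with (2 := Hle n), Hinc.
  apply Nat.lt_le_incl, Nat.pow_gt_lin_r; lia. }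
change (Series (term b d 2) = S0).
pose proof (Series_correct _ Hex) as HS.
(* The sum of the series is the limit along the powers of [b]. *)
assert (Hsub : is_lim_seq (fun L => sum_n (term b d 2) (b ^ L - 1))
  (Series (term b d 2))).
{ apply (is_lim_seq_subseq (sum_n (term b d 2)) _ (fun L => (b ^ L - 1)%nat));
    [|exact HS].
  apply eventually_subseq; intros n.
  pose proof (Nat.pow_lt_mono_r b n (S n) ltac:(lia) ltac:(lia)).
  pose proof (Nat.pow_nonzero b n ltac:(lia)); lia. }
apply is_lim_seq_unique in Hsub; apply is_lim_seq_unique in Hlim.
rewrite (Lim_seq_ext _ (fun L => rsum (b ^ L) (term b d 2))) in Hsub.
- congruence.
- intros L; rewrite sum_n_rsum; f_equal.
  pose proof (Nat.pow_nonzero b L ltac:(lia)); lia.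
Qed.

End Blocks.

(** * The measures minus a multiple of Lebesgue measure *)

(** [F] is a primitive of [f] on [[0, 1]]. *)
Definition primitive01 (f F : R -> R) : Prop :=
  forall x, 0 <= x <= 1 -> is_derive F x (f x).

(** Integration against the signed measure [mu_k - b dx]; the Lebesgue integral
    enters through a primitive [F] of [f]. *)
Definition nu (b d k : nat) (f F : R -> R) : R :=
  mu b d k f - INR b * (F 1 - F 0).

(** [nu_recip b d k n] integrates [1 / (n + x)], [nu_pow b d k c j] integrates
    [(c + x) ^ j]. *)
Definition nu_recip (b d k : nat) (n : R) : R :=
  nu b d k (recip n) (fun x => ln (n + x)).

Definition nu_pow (b d k : nat) (c : R) (j : nat) : R :=
  nu b d k (fun x => (c + x) ^ j) (fun x => (c + x) ^ S j / INR (S j)).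

Lemma primitive_recip n : 0 < n -> primitive01 (recip n) (fun x => ln (n + x)).
Proof.
intros Hn x Hx; unfold recip; auto_derive; [lra|]; field; lra.
Qed.

Lemma primitive_pow c j :
  primitive01 (fun x => (c + x) ^ j) (fun x => (c + x) ^ S j / INR (S j)).
Proof.
intros x Hx; auto_derive; [easy|].
change (Init.Nat.pred (S j)) with j; pose proof (pos_INR j).
change (match j with 0%nat => 1 | S _ => INR j + 1 end) with (INR (S j)).
rewrite S_INR; field; lra.
Qed.

Lemma primitive_scal c f F : primitive01 f F ->
  primitive01 (fun x => c * f x) (fun x => c * F x).
Proof. intros H x Hx; now apply is_derive_scal, H. Qed.

Lemma primitive_rsum n (f F : nat -> R -> R) :
  (forall i, (i < n)%nat -> primitive01 (f i) (F i)) ->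
  primitive01 (fun x => rsum n (fun i => f i x)) (fun x => rsum n (fun i => F i x)).
Proof.
induction n as [|n IH]; intros H x Hx; cbn.
- apply (@is_derive_const R_AbsRing R_NormedModule).
- apply (@is_derive_plus R_AbsRing R_NormedModule).
  + apply IH; [intros; apply H; lia | easy].
  + apply H; [lia | easy].
Qed.

Lemma primitive_diff_le f F M : primitive01 f F ->
  (forall x, 0 <= x <= 1 -> Rabs (f x) <= M) -> Rabs (F 1 - F 0) <= M.
Proof.
intros HF HM; destruct (MVT_gen F 0 1 f) as [c [Hc Heq]].
- intros x; rewrite Rmin_left, Rmax_right by lra; intros; apply HF; lra.
- intros x; rewrite Rmin_left, Rmax_right by lra; intros Hx.
  apply continuity_pt_filterlim, (ex_derive_continuous F); eexists; now apply HF.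
- rewrite Rmin_left, Rmax_right in Hc by lra; rewrite Heq, Rminus_0_r, Rmult_1_r; auto.
Qed.

Lemma bounded01_pow c j : 0 <= c -> bounded01 (fun x => (c + x) ^ j).
Proof.
intros Hc; exists ((c + 1) ^ j); intros x Hx.
rewrite Rabs_pos_eq by (apply pow_le; lra); apply pow_incr; lra.
Qed.

Section SignedMeasures.
Context (b d : nat) (Hb : (2 <= b)%nat) (Hd : (d < b)%nat).

Lemma nu_ext k f F g G : (forall x, 0 <= x <= 1 -> f x = g x) ->
  F 1 - F 0 = G 1 - G 0 -> nu b d k f F = nu b d k g G.
Proof. intros H Heq; unfold nu; rewrite Heq, (mu_ext b d Hb Hd k f g); easy. Qed.

(** Both measures have mass [b]; the mean value theorem bounds the integral with
    respect to Lebesgue measure. *)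
Lemma nu_close k f F g G M : bounded01 f -> bounded01 g ->
  primitive01 f F -> primitive01 g G ->
  (forall x, 0 <= x <= 1 -> Rabs (f x - g x) <= M) ->
  Rabs (nu b d k f F - nu b d k g G) <= 2 * INR b * M.
Proof.
intros Bf Bg HF HG HM; unfold nu; pose proof (b_pos b Hb).
replace (mu b d k f - INR b * (F 1 - F 0) - (mu b d k g - INR b * (G 1 - G 0)))
  with (mu b d k (fun x => -1 * g x + f x)
        - INR b * ((-1 * G 1 + F 1) - (-1 * G 0 + F 0)))
  by (rewrite (mu_lin b d Hb Hd) by easy; lra).
assert (HM' : forall x, 0 <= x <= 1 -> Rabs (-1 * g x + f x) <= M).
{ intros x Hx; replace (-1 * g x + f x) with (f x - g x) by lra; auto. }
unfold Rminus at 1; eapply Rle_trans; [apply Rabs_triang|].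
pose proof (mu_abs_le b d Hb Hd k _ M HM').
pose proof (primitive_diff_le (fun x => -1 * g x + f x) (fun x => -1 * G x + F x) M)
  as H3.
rewrite Rabs_Ropp, Rabs_mult, (Rabs_pos_eq (INR b)) by lra.
assert (H4 : Rabs (-1 * G 1 + F 1 - (-1 * G 0 + F 0)) <= M).
{ apply H3; [|easy]; intros x Hx; apply (@is_derive_plus R_AbsRing R_NormedModule);
    [apply is_derive_scal|]; auto. }
apply (Rmult_le_compat_l (INR b)) in H4; lra.
Qed.

Lemma nu_eq k f F g G : bounded01 f -> bounded01 g ->
  primitive01 f F -> primitive01 g G -> (forall x, 0 <= x <= 1 -> f x = g x) ->
  nu b d k f F = nu b d k g G.
Proof.
intros Bf Bg HF HG Heq.
assert (H : Rabs (nu b d k f F - nu b d k g G) <= 2 * INR b * 0).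
{ apply nu_close; auto; intros x Hx; rewrite Heq, Rminus_diag, Rabs_R0; auto; lra. }
rewrite Rmult_0_r in H; apply Rabs_le_between in H; lra.
Qed.

Lemma nu_rsum k n (f F : nat -> R -> R) :
  (forall i, (i < n)%nat -> bounded01 (f i)) ->
  nu b d k (fun x => rsum n (fun i => f i x)) (fun x => rsum n (fun i => F i x))
  = rsum n (fun i => nu b d k (f i) (F i)).
Proof.
intros H; unfold nu; rewrite (mu_rsum b d Hb Hd) by easy.
now rewrite rsum_minus, rsum_scal, rsum_minus.
Qed.

Lemma nu_scal k c f F : bounded01 f ->
  nu b d k (fun x => c * f x) (fun x => c * F x) = c * nu b d k f F.
Proof.
intros Hf; unfold nu; rewrite (mu_ext b d Hb Hd k _ (fun x => (c - 1) * f x + f x)),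
  (mu_lin b d Hb Hd) by (easy || (intros; ring)); ring.
Qed.

(** Lebesgue measure is self-similar as well, so [nu] inherits [mu_step], except
    that for [k = 0] a Lebesgue term remains. *)
Lemma nu_step k f F : bounded01 f ->
  nu b d k f F = (if Nat.eqb k 0 then f 0 else 0)
    + rsum b (fun a => nu b d k (digit_branch b a f) (fun x => F ((INR a + x) / INR b)))
    - nu b d k (digit_branch b d f) (fun x => F ((INR d + x) / INR b))
    + match k with
      | O => - (INR b * (F ((INR d + 1) / INR b) - F ((INR d + 0) / INR b)))
      | S k' => nu b d k' (digit_branch b d f) (fun x => F ((INR d + x) / INR b))
      end.
Proof.
intros Hf; pose proof (b_pos b Hb); unfold nu.
rewrite (mu_step b d Hb Hd k f Hf), rsum_minus, rsum_scal.
rewrite (rsum_ext b (fun i => F ((INR i + 1) / INR b) - F ((INR i + 0) / INR b))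
  (fun i => F (INR (S i) / INR b) - F (INR i / INR b)))
  by (intros; rewrite S_INR, Rplus_0_r; easy).
rewrite (rsum_tele b (fun i => F (INR i / INR b))); cbn [INR].
replace (INR b / INR b) with 1 by (field; lra).
replace (0 / INR b) with 0 by (field; lra).
destruct k; ring.
Qed.

(** Appending one more digit [a] to [n] turns it into [n * b + a], with one more
    occurrence if [a = d]; the logarithms telescope. *)
Lemma nu_recip_step k n : (0 < n)%nat ->
  nu_recip b d (S k) (INR n)
  = rsum b (fun a => nu_recip b d (S k) (INR (n * b + a)))
    - nu_recip b d (S k) (INR (n * b + d)) + nu_recip b d k (INR (n * b + d)).
Proof.
intros Hn; pose proof (b_pos b Hb); assert (Hn' : 0 < INR n) by (now apply lt_0_INR).
assert (Heq : forall k a, nu b d k (digit_branch b a (recip (INR n)))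
    (fun x => ln (INR n + (INR a + x) / INR b)) = nu_recip b d k (INR (n * b + a))).
{ intros k' a; pose proof (pos_INR a); apply nu_ext.
  - intros; apply recip_branch; (easy || lra).
  - assert (L : forall x, 0 <= x ->
      ln (INR (n * b + a) + x) = ln (INR b) + ln (INR n + (INR a + x) / INR b)).
    { intros x Hx.
      assert (0 <= (INR a + x) / INR b) by (apply Rdiv_le_0_compat; lra).
      rewrite <- ln_mult by lra; f_equal.
      rewrite plus_INR, mult_INR; field; lra. }
    rewrite !L by lra; ring. }
unfold nu_recip at 1; rewrite (nu_step (S k) (recip (INR n)))
  by now apply bounded01_recip.
cbn [Nat.eqb]; rewrite !Heq,
  (rsum_ext b _ (fun a => nu_recip b d (S k) (INR (n * b + a))))
  by (intros; apply Heq); ring.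
Qed.

Lemma nu_pow_0 k c : nu_pow b d k c 0 = 0.
Proof.
unfold nu_pow, nu; cbn [pow]; rewrite (mu_mass b d Hb Hd); cbn [INR]; field.
Qed.

(** [nu_step] for the function [x ^ m]. *)
Lemma nu_pow_step k m : (0 < m)%nat ->
  INR b ^ S m * nu_pow b d k 0 m
  = rsum b (fun a => nu_pow b d k (INR a) m) - nu_pow b d k (INR d) m
    + match k with
      | O => - (INR b * ((INR d + 1) ^ S m / INR (S m) - INR d ^ S m / INR (S m)))
      | S k' => nu_pow b d k' (INR d) m
      end.
Proof.
intros Hm; pose proof (b_pos b Hb).
assert (Hm' : INR (S m) <> 0) by (apply not_0_INR; lia).
assert (Hp : INR b ^ S m <> 0) by (apply pow_nonzero; lra).
set (t := / INR b ^ S m).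
assert (Heq : forall k a, nu b d k (digit_branch b a (fun x => (0 + x) ^ m))
    (fun x => (0 + (INR a + x) / INR b) ^ S m / INR (S m))
      = t * nu_pow b d k (INR a) m).
{ intros k' a; unfold nu_pow.
  rewrite <- nu_scal by apply bounded01_pow, pos_INR.
  apply nu_ext.
  - intros x _; unfold digit_branch, t; rewrite Rplus_0_l; unfold Rdiv.
    rewrite Rpow_mult_distr, pow_inv; cbn [pow]; field.
    split; [now apply pow_nonzero, Rgt_not_eq | lra].
  - rewrite !Rplus_0_l; unfold t, Rdiv; rewrite !Rpow_mult_distr, !pow_inv; ring. }
unfold nu_pow at 1; rewrite nu_step by (apply bounded01_pow; lra).
rewrite (rsum_ext b _ (fun a => t * nu_pow b d k (INR a) m)), rsum_scal, Heq
  by (intros; apply Heq).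
replace (if (k =? 0)%nat then (0 + 0) ^ m else 0) with 0
  by (rewrite Rplus_0_l, pow_i by easy; now destruct (k =? 0)%nat).
destruct k as [|k].
- rewrite !Rplus_0_l, Rplus_0_r; unfold Rdiv; rewrite !Rpow_mult_distr, !pow_inv.
  fold t; field_simplify; [|lra|easy]; unfold t; field; now split.
- rewrite Heq; unfold t; field; easy.
Qed.

Lemma nu_pow_binomial k c j : 0 <= c ->
  nu_pow b d k c j = rsum (S j) (fun i =>
    Binomial.C j i * c ^ (j - i) * nu_pow b d k 0 i).
Proof.
intros Hc.
rewrite (rsum_ext (S j) _ (fun i => nu b d k
  (fun x => Binomial.C j i * c ^ (j - i) * (0 + x) ^ i)
  (fun x => Binomial.C j i * c ^ (j - i) * ((0 + x) ^ S i / INR (S i)))))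
  by (intros; unfold nu_pow; rewrite nu_scal; [easy | apply bounded01_pow; lra]).
assert (Bs : forall (e : R) i, bounded01 (fun x => e * (0 + x) ^ i)).
{ intros e i; apply bounded01_ext with (fun x => e * (0 + x) ^ i + 0);
    [intros; ring|].
  apply bounded01_lin; [apply bounded01_pow; lra | apply bounded01_const]. }
rewrite <- nu_rsum by auto.
apply nu_eq.
- now apply bounded01_pow.
- now apply bounded01_rsum.
- apply primitive_pow.
- apply (primitive_rsum (S j)
    (fun i x => Binomial.C j i * c ^ (j - i) * (0 + x) ^ i)
    (fun i x => Binomial.C j i * c ^ (j - i) * ((0 + x) ^ S i / INR (S i)))).
  intros; apply primitive_scal, primitive_pow.
- intros x _; rewrite Rplus_comm, binomial, sum_f_R0_rsum.
  apply rsum_ext; intros i _; rewrite Rplus_0_l; ring.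
Qed.

(** The integrated expansion of [1 / (M + c + x)] in powers of [(c + x) / M]; its
    remainder is [(- (c + x) / M) ^ N / (M + c + x)]. *)
Lemma nu_recip_expand k M c N : 0 < M -> 0 <= c ->
  Rabs (nu_recip b d k (M + c)
    - rsum N (fun j => (-1) ^ j / M ^ S j * nu_pow b d k c j))
  <= 2 * INR b * ((c + 1) ^ N / M ^ S N).
Proof.
intros HM Hc.
rewrite (rsum_ext N _ (fun j => nu b d k
  (fun x => (-1) ^ j / M ^ S j * (c + x) ^ j)
  (fun x => (-1) ^ j / M ^ S j * ((c + x) ^ S j / INR (S j)))))
  by (intros; unfold nu_pow; rewrite nu_scal; [easy | now apply bounded01_pow]).
assert (Bs : forall (e : R) i, bounded01 (fun x => e * (c + x) ^ i)).
{ intros e i; apply bounded01_ext with (fun x => e * (c + x) ^ i + 0);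
    [intros; ring|].
  apply bounded01_lin; [now apply bounded01_pow | apply bounded01_const]. }
rewrite <- nu_rsum by auto.
apply nu_close.
- apply bounded01_recip; lra.
- now apply bounded01_rsum.
- apply primitive_recip; lra.
- apply (primitive_rsum N
    (fun j x => (-1) ^ j / M ^ S j * (c + x) ^ j)
    (fun j x => (-1) ^ j / M ^ S j * ((c + x) ^ S j / INR (S j)))).
  intros; apply primitive_scal, primitive_pow.
- intros x Hx.
  assert (Heq : recip (M + c) x - rsum N (fun i => (-1) ^ i / M ^ S i * (c + x) ^ i)
    = (-1) ^ N * ((c + x) ^ N / M ^ N * / (M + c + x))).
  { induction N as [|N IH]; cbn [rsum]; [unfold recip; cbn; field; lra|].
    assert (M ^ N <> 0) by (apply pow_nonzero; lra).
    transitivity ((-1) ^ N * ((c + x) ^ N / M ^ N * / (M + c + x))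
      - (-1) ^ N / M ^ S N * (c + x) ^ N); [rewrite <- IH; ring|].
    cbn [pow]; field; repeat split; lra. }
  rewrite Heq, Rabs_mult, pow_1_abs, Rmult_1_l.
  pose proof (pow_lt M N HM); pose proof (pow_le (c + x) N ltac:(lra)).
  rewrite Rabs_pos_eq.
  2:{ apply Rmult_le_pos; [apply Rdiv_le_0_compat; lra|].
      left; apply Rinv_0_lt_compat; lra. }
  replace ((c + 1) ^ N / M ^ S N) with ((c + 1) ^ N / M ^ N * / M)
    by (cbn [pow]; field; lra).
  apply Rmult_le_compat.
  + apply Rdiv_le_0_compat; lra.
  + left; apply Rinv_0_lt_compat; lra.
  + apply Rmult_le_compat_r; [left; now apply Rinv_0_lt_compat|].
    apply pow_incr; lra.
  + apply Rinv_le_contravar; lra.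
Qed.

Lemma nu_recip_bound k n : 0 < n -> Rabs (nu_recip b d k n) <= 2 * INR b * / n ^ 2.
Proof.
intros Hn; pose proof (nu_recip_expand k n 0 1 Hn ltac:(lra)) as H.
cbn [rsum] in H; rewrite nu_pow_0, Rplus_0_r, Rmult_0_r, Rplus_0_r, Rminus_0_r in H.
now rewrite Rplus_0_l, pow1, Rdiv_1_l in H.
Qed.

End SignedMeasures.

Lemma ex_series_inv_pow s : (2 <= s)%nat -> ex_series (fun n => / INR (S n) ^ s).
Proof.
intros Hs.
assert (Hpos : forall n, 1 <= INR (S n))
  by (intros; rewrite S_INR; pose proof (pos_INR n); lra).
apply ex_series_nonneg_bounded with 2.
- intros n; specialize (Hpos n); left; apply Rinv_0_lt_compat, pow_lt; lra.
- assert (H : forall n, rsum (S n) (fun n => / INR (S n) ^ s) <= 2 - / INR (S n)).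
  { induction n as [|n IH].
    - cbn [rsum INR]; rewrite pow1; lra.
    - remember (S n) as m eqn:Em; cbn [rsum].
      assert (Hm : 1 <= INR m) by (rewrite Em; apply Hpos).
      assert (/ INR (S m) ^ s <= / INR (S m) ^ 2).
      { apply Rinv_le_contravar; [apply pow_lt | apply Rle_pow]; auto.
        rewrite S_INR; lra. }
      assert (/ INR (S m) ^ 2 <= / INR m - / INR (S m)); [|lra].
      rewrite S_INR; apply Rle_trans with (/ (INR m * (INR m + 1))).
      + apply Rinv_le_contravar; nra.
      + right; field; lra. }
  intros [|n]; [cbn; lra|].
  specialize (H n); specialize (Hpos n).
  assert (0 < / INR (S n)) by (apply Rinv_0_lt_compat; lra); lra.
Qed.

(** * An exact formula for the sum *)

Section ExactFormula.
Context (b d : nat) (Hb : (2 <= b)%nat) (Hd : (d < b)%nat) (Hd0 : (0 < d)%nat).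

(** The first and second differences of [nu_recip] with respect to the number of
    occurrences. *)
Definition nu_recip_d1 (b d : nat) (n : R) : R := nu_recip b d 1 n - nu_recip b d 2 n.
Definition nu_recip_d2 (b d : nat) (n : R) : R := nu_recip b d 0 n
  - 2 * nu_recip b d 1 n + nu_recip b d 2 n.

Lemma digit_harmonic_sum_nu_recip :
  digit_harmonic_sum b d 2 - INR b * ln (INR b)
  = rsum (b - 1) (fun i => nu_recip b d 2 (INR (S i))) + nu_recip_d1 b d (INR d).
Proof.
rewrite digit_harmonic_sum_mu by easy; unfold nu_recip_d1, nu_recip, nu.
rewrite rsum_minus, rsum_scal.
rewrite (rsum_ext (b - 1) (fun i => ln (INR (S i) + 1) - ln (INR (S i) + 0))
  (fun i => ln (INR (S (S i))) - ln (INR (S i))))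
  by (intros i _; rewrite (S_INR (S i)), Rplus_0_r; easy).
rewrite (rsum_tele (b - 1) (fun i => ln (INR (S i)))).
replace (S (b - 1)) with b by lia; cbn [INR]; rewrite ln_1; ring.
Qed.

Lemma ex_series_nu_recip : ex_series (fun i => nu_recip b d 2 (INR (S i))).
Proof.
apply (@ex_series_le R_AbsRing R_CompleteNormedModule _
  (fun i => 2 * INR b * / INR (S i) ^ 2)).
- intros n; apply (nu_recip_bound b d Hb Hd 2), lt_0_INR; lia.
- apply (@ex_series_scal R_AbsRing R_NormedModule (2 * INR b)), ex_series_inv_pow; lia.
Qed.

(** Summing [nu_recip_step] over all [n > 0], the sums over [n] and over [n * b + a]
    cancel except for the terms with [n < b]. *)
Lemma is_series_nu_recip_d1 :
  is_series (fun i => nu_recip_d1 b d (INR (S i * b + d)))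
    (rsum (b - 1) (fun i => nu_recip b d 2 (INR (S i)))).
Proof.
set (p := fun n => rsum n (fun i => nu_recip b d 2 (INR (S i)))).
assert (Heq : forall M, rsum M (fun i => nu_recip_d1 b d (INR (S i * b + d)))
  = p M - p (b - 1 + M * b)%nat + p (b - 1)%nat).
{ intros M; unfold p at 2; rewrite rsum_add; fold (p (b - 1)%nat).
  rewrite rsum_mul; unfold p at 1.
  enough (Heq : rsum M (fun i => nu_recip b d 2 (INR (S i)))
    - rsum M (fun i => rsum b (fun a => nu_recip b d 2 (INR (S (b - 1 + (i * b + a))))))
    = rsum M (fun i => nu_recip_d1 b d (INR (S i * b + d)))) by lra.
  rewrite <- rsum_minus; apply rsum_ext; intros i _.
  rewrite (nu_recip_step b d Hb Hd 1 (S i)) by lia; unfold nu_recip_d1.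
  rewrite (rsum_ext b (fun a => nu_recip b d 2 (INR (S (b - 1 + (i * b + a)))))
    (fun a => nu_recip b d 2 (INR (S i * b + a))))
    by (intros; do 2 f_equal; lia).
  lra. }
destruct ex_series_nu_recip as [l Hl].
assert (Hp : is_lim_seq p l).
{ apply is_lim_seq_incr_1;
  apply (is_lim_seq_ext (sum_n (fun i => nu_recip b d 2 (INR (S i)))));
    [intros; apply sum_n_rsum | exact Hl]. }
apply (is_lim_seq_ext (fun M => p (S M) - p (b - 1 + S M * b)%nat + p (b - 1)%nat)
  _ (rsum (b - 1) (fun i => nu_recip b d 2 (INR (S i))))).
{ intros M; now rewrite sum_n_rsum, Heq. }
replace (rsum (b - 1) (fun i => nu_recip b d 2 (INR (S i)))) with (l - l
  + p (b - 1)%nat)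
  by (unfold p; ring).
apply is_lim_seq_plus'; [|apply is_lim_seq_const].
apply is_lim_seq_minus'.
- now apply (is_lim_seq_incr_1 p).
- apply (is_lim_seq_subseq p _ (fun M => (b - 1 + S M * b)%nat)); [|easy].
  apply eventually_subseq; intros; nia.
Qed.

(** Here [nu_recip_step] is applied once more to [n = d], because [1 / (d + x)] itself
    has no expansion in inverse powers of [b]: every kernel [1 / (n + x)] on the
    right-hand side has [n >= b]. *)
Theorem exact_formula :
  digit_harmonic_sum b d 2 - INR b * ln (INR b)
  = Series (fun i => nu_recip_d1 b d (INR (S i * b + d)))
    + rsum b (fun a => nu_recip_d1 b d (INR (d * b + a)))
    + nu_recip_d2 b d (INR (d * b + d)).
Proof.
rewrite digit_harmonic_sum_nu_recip, (is_series_unique _ _ is_series_nu_recip_d1).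
unfold nu_recip_d1 at 1; rewrite (nu_recip_step b d Hb Hd 0 d),
  (nu_recip_step b d Hb Hd 1 d) by easy.
unfold nu_recip_d1, nu_recip_d2; rewrite rsum_minus; ring.
Qed.

End ExactFormula.

(** * Calculus of asymptotic expansions in inverse powers *)

(** [f b] is bounded for all large [b]. *)
Definition bdd (f : nat -> R) : Prop :=
  exists C, eventually (fun b => Rabs (f b) <= C).

(** [expansion [c_0; ...; c_{n-1}] f] says that
    [f b = c_0 + c_1 / b + ... + c_{n-1} / b ^ (n-1) + O (b ^ -n)].
    The recursion removes the leading coefficient and rescales. *)
Fixpoint expansion (l : list R) (f : nat -> R) : Prop :=
  match l with
  | nil => bdd f
  | c :: l' => expansion l' (fun b => INR b * (f b - c))
  end.

(** [f] has an expansion with [N] coefficients. *)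
Definition expandable (N : nat) (f : nat -> R) : Prop :=
  exists l, length l = N /\ expansion l f.

Lemma eventually_ge n : eventually (fun b => (n <= b)%nat).
Proof. now exists n. Qed.

Lemma eventually_pos : eventually (fun b => 0 < INR b).
Proof. exists 1%nat; intros; apply lt_0_INR; lia. Qed.

Lemma bdd_ext f g : eventually (fun b => f b = g b) -> bdd f -> bdd g.
Proof.
intros H [C HC]; exists C; generalize (filter_and _ _ H HC).
apply filter_imp; intros b [<- Hb]; easy.
Qed.

Lemma bdd_plus f g : bdd f -> bdd g -> bdd (fun b => f b + g b).
Proof.
intros [C HC] [C' HC']; exists (C + C'); generalize (filter_and _ _ HC HC').
apply filter_imp; intros b [H H']; eapply Rle_trans; [apply Rabs_triang|lra].
Qed.

Lemma bdd_mult f g : bdd f -> bdd g -> bdd (fun b => f b * g b).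
Proof.
intros [C HC] [C' HC']; exists (C * C'); generalize (filter_and _ _ HC HC').
apply filter_imp; intros b [H H']; rewrite Rabs_mult.
apply Rmult_le_compat; auto using Rabs_pos.
Qed.

Lemma bdd_const c : bdd (fun _ => c).
Proof. exists (Rabs c); apply filter_forall; intros; lra. Qed.

Lemma bdd_inv : bdd (fun b => / INR b).
Proof.
exists 1, 1%nat; intros b Hb; apply le_INR in Hb; cbn in Hb.
rewrite Rabs_pos_eq by (left; apply Rinv_0_lt_compat; lra).
rewrite <- Rinv_1; apply Rinv_le_contravar; lra.
Qed.

Lemma expansion_ext l : forall f g, eventually (fun b => f b = g b) -> expansion l f ->
  expansion l g.
Proof.
induction l as [|c l IH]; intros f g H; [now apply bdd_ext|].
apply IH; revert H; apply filter_imp; intros b ->; easy.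
Qed.

Lemma expansion_cons c l f g : eventually (fun b => f b = c + g b / INR b) ->
  expansion l g -> expansion (c :: l) f.
Proof.
intros H; apply (expansion_ext l g); generalize (filter_and _ _ H eventually_pos).
apply filter_imp; intros b [-> Hb]; field; lra.
Qed.

Lemma expansion_bdd l : forall f, expansion l f -> bdd f.
Proof.
induction l as [|c l IH]; intros f H; [exact H|].
apply bdd_ext with (fun b => c + (INR b * (f b - c)) * / INR b).
- generalize eventually_pos; apply filter_imp; intros b Hb; field; lra.
- apply bdd_plus; [apply bdd_const|]; apply bdd_mult; [now apply IH | apply bdd_inv].
Qed.

Lemma expansion_firstn n : forall l f, expansion l f -> expansion (firstn n l) f.
Proof.
induction n as [|n IH]; intros l f H; [now apply expansion_bdd in H|].
destruct l as [|c l]; [easy|]; cbn; now apply IH.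
Qed.

(** Sum of two truncated series, truncated to the shorter length. *)
Fixpoint ladd (l l' : list R) : list R :=
  match l, l' with c :: l, c' :: l' => c + c' :: ladd l l' | _, _ => nil end.

(** Cauchy product, truncated to the shorter length: if [f = c + f' / b] then
    [f * g = c * g + (f' * g) / b]. *)
Fixpoint lmul (l l' : list R) : list R :=
  match l, l' with
  | c :: l, c' :: m => c * c' :: ladd (map (Rmult c) m) (lmul l l')
  | _, _ => nil
  end.

(** Quotient of [num] by [c :: l], with at most [n] coefficients. *)
Fixpoint ldiv (n : nat) (num : list R) (c : R) (l : list R) : list R :=
  match n, num with
  | S n, h0 :: num => h0 / c :: ldiv n (ladd num (map (Rmult (- (h0 / c))) l)) c l
  | _, _ => nil
  end.

Lemma expansion_add l : forall l' f g, expansion l f -> expansion l' g ->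
  expansion (ladd l l') (fun b => f b + g b).
Proof.
induction l as [|c l IH]; intros l' f g Hf Hg;
  [apply expansion_bdd in Hg; now apply bdd_plus|].
destruct l' as [|c' l']; [apply expansion_bdd in Hf; now apply bdd_plus|].
cbn in *; generalize (IH _ _ _ Hf Hg); apply expansion_ext, filter_forall; intros; ring.
Qed.

Lemma expansion_scal c l : forall f, expansion l f ->
  expansion (map (Rmult c) l) (fun b => c * f b).
Proof.
induction l as [|c' l IH]; intros f H; [apply bdd_mult; [apply bdd_const | easy]|].
cbn in *; generalize (IH _ H); apply expansion_ext, filter_forall; intros; ring.
Qed.

Lemma expansion_mul l : forall l' f g, expansion l f -> expansion l' g ->
  expansion (lmul l l') (fun b => f b * g b).
Proof.
induction l as [|c l IH]; intros l' f g Hf Hg;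
  [apply expansion_bdd in Hg; now apply bdd_mult|].
destruct l' as [|c' l']; [apply expansion_bdd in Hf; now apply bdd_mult|].
cbn [lmul expansion]; cbn [expansion] in Hf.
generalize (expansion_add _ _ _ _ (expansion_scal c l' _ Hg) (IH _ _ _ Hf Hg)).
apply expansion_ext, filter_forall; intros; ring.
Qed.

Lemma expansion_const c n : expansion (c :: repeat 0 n) (fun _ => c).
Proof.
revert c; induction n as [|n IH]; intros c.
- apply bdd_ext with (fun _ => 0);
  [apply filter_forall; intros; ring | apply bdd_const].
- apply expansion_cons with (fun _ => 0); [|apply IH].
  apply filter_forall; intros; unfold Rdiv; ring.
Qed.

Lemma expansion_over_b l f : expansion l f -> expansion (0 :: l) (fun b => f b / INR b).
Proof. apply expansion_cons, filter_forall; intros; ring. Qed.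

Lemma bdd_div c f g : c <> 0 -> bdd (fun b => INR b * (f b - c)) ->
  bdd (fun b => f b * g b) -> bdd g.
Proof.
intros Hc [C HC] [D HD]; exists (D * (2 / Rabs c)).
assert (Hc' : 0 < Rabs c) by now apply Rabs_pos_lt.
destruct (nfloor_ex (Rmax 0 (2 * C / Rabs c)) (Rmax_l _ _)) as [n [_ Hn]].
generalize (filter_and _ _ (filter_and _ _ HC HD) (eventually_ge (S n))).
apply filter_imp; intros b [[H1 H2] H3].
assert (Hb : 2 * C / Rabs c <= INR b).
{ apply le_INR in H3; rewrite S_INR in H3.
  pose proof (Rmax_r 0 (2 * C / Rabs c)); lra. }
assert (H0 : 0 < INR b) by (apply lt_0_INR; lia).
rewrite Rabs_mult, (Rabs_pos_eq (INR b)) in H1 by lra.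
apply Rle_div_l in Hb; [|easy].
assert (H4 : Rabs (f b - c) <= Rabs c / 2) by (apply (Rmult_le_reg_l (INR b)); lra).
assert (H5 : Rabs c / 2 <= Rabs (f b)).
{ pose proof (Rabs_triang (f b) (c - f b)).
  replace (f b + (c - f b)) with c in H by ring.
  rewrite Rabs_minus_sym in H4; lra. }
rewrite Rabs_mult in H2.
apply (Rmult_le_reg_l (Rabs c / 2)); [lra|].
replace (Rabs c / 2 * (D * (2 / Rabs c))) with D by (field; lra).
apply Rle_trans with (2 := H2), Rmult_le_compat_r; [apply Rabs_pos | easy].
Qed.

Lemma expansion_div c l f : c <> 0 -> expansion (c :: l) f -> forall n lh g,
  expansion lh (fun b => f b * g b) -> expansion (ldiv n lh c l) g.
Proof.
intros Hc Hf; induction n as [|n IH]; intros lh g Hg.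
{ apply expansion_bdd in Hg; apply (bdd_div c f g Hc);
  [now apply (expansion_bdd l) | easy]. }
destruct lh as [|h0 lh].
{ apply (bdd_div c f g Hc); [now apply (expansion_bdd l) | easy]. }
cbn [ldiv expansion]; apply IH.
generalize (expansion_add lh _ _ _ Hg (expansion_scal (- (h0 / c)) l _ Hf)).
apply expansion_ext, filter_forall; intros; field; easy.
Qed.

Fixpoint horner (l : list R) (t : R) : R :=
  match l with nil => 0 | c :: l => c + t * horner l t end.

Lemma expansion_bound l : forall f, expansion l f ->
  exists C, eventually (fun b =>
    Rabs (f b - horner l (/ INR b)) <= C * / INR b ^ length l).
Proof.
induction l as [|c l IH]; intros f Hf.
- destruct Hf as [C HC]; exists C; revert HC; apply filter_imp; intros b H.
  cbn; rewrite Rminus_0_r, Rinv_1, Rmult_1_r; easy.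
- destruct (IH _ Hf) as [C HC]; exists C.
  generalize (filter_and _ _ HC eventually_pos); apply filter_imp; intros b [H Hb].
  cbn [horner length].
  replace (f b - (c + / INR b * horner l (/ INR b)))
    with (/ INR b * (INR b * (f b - c) - horner l (/ INR b))) by (field; lra).
  pose proof (Rinv_0_lt_compat _ Hb).
  rewrite Rabs_mult, (Rabs_pos_eq (/ INR b)) by lra.
  apply (Rmult_le_compat_l (/ INR b)) in H; [|lra].
  eapply Rle_trans; [exact H|]; right; cbn [pow]; rewrite Rinv_mult; ring.
Qed.

Lemma ladd_length l : forall l', length (ladd l l') = Nat.min (length l) (length l').
Proof. induction l as [|c l IH]; intros [|c' l']; cbn; try easy; now rewrite IH. Qed.

Lemma lmul_length l : forall l', length (lmul l l') = Nat.min (length l) (length l').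
Proof.
induction l as [|c l IH]; intros [|c' l']; cbn; try easy.
rewrite ladd_length, length_map, IH; cbn [length]; lia.
Qed.

Lemma ldiv_length n : forall num c l, (length num <= n)%nat ->
  (length num <= S (length l))%nat -> length (ldiv n num c l) = length num.
Proof.
induction n as [|n IH]; intros [|h0 num] c l Hn Hl; cbn in *; try easy; try lia.
rewrite IH; rewrite ladd_length, length_map; lia.
Qed.

Lemma expandable_ext N f g : eventually (fun b => f b = g b) -> expandable N f ->
  expandable N g.
Proof. intros H [l [Hl Hf]]; exists l; split; [easy|];
  now apply expansion_ext with f. Qed.

Lemma expandable_ext_all N f g : (forall b, f b = g b) -> expandable N f ->
  expandable N g.
Proof. intros H; now apply expandable_ext, filter_forall. Qed.

Lemma expandable_le N M f : (N <= M)%nat -> expandable M f -> expandable N f.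
Proof.
intros H [l [Hl Hf]]; exists (firstn N l); split.
- rewrite length_firstn; lia.
- now apply expansion_firstn.
Qed.

Lemma expandable_bdd N f : expandable N f -> bdd f.
Proof. intros [l [_ H]]; now apply expansion_bdd in H. Qed.

Lemma expandable_0 f : bdd f -> expandable 0 f.
Proof. now exists nil. Qed.

Lemma expandable_const N c : expandable N (fun _ => c).
Proof.
apply expandable_le with (S N); [lia|]; exists (c :: repeat 0 N); split.
- cbn; now rewrite repeat_length.
- apply expansion_const.
Qed.

Lemma expandable_plus N f g : expandable N f -> expandable N g ->
  expandable N (fun b => f b + g b).
Proof.
intros [l [Hl Hf]] [l' [Hl' Hg]]; exists (ladd l l'); split.
- rewrite ladd_length; lia.
- now apply expansion_add.
Qed.

Lemma expandable_mult N f g : expandable N f -> expandable N g ->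
  expandable N (fun b => f b * g b).
Proof.
intros [l [Hl Hf]] [l' [Hl' Hg]]; exists (lmul l l'); split.
- rewrite lmul_length; lia.
- now apply expansion_mul.
Qed.

Lemma expandable_scal N c f : expandable N f -> expandable N (fun b => c * f b).
Proof. intros; now apply expandable_mult; [apply expandable_const|]. Qed.

Lemma expandable_opp N f : expandable N f -> expandable N (fun b => - f b).
Proof. intros H; generalize (expandable_scal N (-1) f H); apply expandable_ext_all;
  intros; ring. Qed.

Lemma expandable_minus N f g : expandable N f -> expandable N g ->
  expandable N (fun b => f b - g b).
Proof. intros; now apply expandable_plus; [|apply expandable_opp]. Qed.

Lemma expandable_rsum N n (f : nat -> nat -> R) :
  (forall i, (i < n)%nat -> expandable N (f i)) ->
    expandable N (fun b => rsum n (fun i => f i b)).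
Proof.
induction n as [|n IH]; intros H; cbn; [apply expandable_const|].
apply expandable_plus; [apply IH; intros|]; apply H; lia.
Qed.

Lemma expandable_over_b N f : expandable N f -> expandable (S N) (fun b => f b / INR b).
Proof.
intros [l [Hl Hf]]; exists (0 :: l); split; [cbn; lia | now apply expansion_over_b].
Qed.

Lemma expandable_inv N : expandable N (fun b => / INR b).
Proof.
apply expandable_le with (S N); [lia|].
apply expandable_ext_all with (fun b => 1 / INR b); [intros; unfold Rdiv; ring|].
apply expandable_over_b, expandable_const.
Qed.

Lemma expandable_pow N f k : expandable N f -> expandable N (fun b => f b ^ k).
Proof.
intros H; induction k as [|k IH]; cbn;
  [apply expandable_const | now apply expandable_mult].
Qed.

Lemma expandable_inv_pow N k : expandable N (fun b => (/ INR b) ^ k).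
Proof. apply expandable_pow, expandable_inv. Qed.

(** Expansions can be divided by a function with nonzero limit [c]. *)
Lemma expandable_div N f g c : c <> 0 -> expandable N (fun b => INR b * (f b - c)) ->
  expandable N (fun b => f b * g b) -> expandable N g.
Proof.
intros Hc [l [Hl Hf]] [lh [Hlh Hg]]; exists (ldiv N lh c l); split.
- rewrite ldiv_length; lia.
- now apply expansion_div with f.
Qed.

(** Remove the limit of [f] and rescale; the coefficients of the full expansion
    are the successive limits. This gives one sequence of coefficients that
    serves for every [N], although [expandable N f] only asserts the existence of a list
    for each [N]. *)
Definition tail_step (f : nat -> R) (b : nat) : R := INR b * (f b - real (Lim_seq f)).

Fixpoint tails (n : nat) (f : nat -> R) : nat -> R :=
  match n with O => f | S n => tail_step (tails n f) end.

Lemma is_lim_expansion c l f : expansion (c :: l) f -> is_lim_seq f c.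
Proof.
intros H; apply (expansion_bdd l) in H; destruct H as [C HC].
apply (is_lim_seq_ext_loc (fun b => c + (INR b * (f b - c)) * / INR b)).
{ generalize eventually_pos; apply filter_imp; intros b Hb; field; lra. }
replace (Finite c) with (Finite (c + 0)) by (f_equal; ring).
apply is_lim_seq_plus'; [apply is_lim_seq_const|].
apply is_lim_seq_abs_0.
apply (is_lim_seq_le_le_loc (fun _ => 0) _ (fun b => C * / INR b)).
- generalize (filter_and _ _ HC eventually_pos); apply filter_imp; intros b [H Hb].
  split; [apply Rabs_pos|]; rewrite Rabs_mult.
  pose proof (Rinv_0_lt_compat _ Hb); rewrite (Rabs_pos_eq (/ INR b)) by lra.
  apply Rmult_le_compat_r; [lra | easy].
- apply is_lim_seq_const.
- replace (Finite 0) with (Rbar_mult C 0) by (cbn; f_equal; ring).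
  apply is_lim_seq_scal_l.
  replace (Finite 0) with (Rbar_inv p_infty) by easy.
  apply is_lim_seq_inv; [apply is_lim_seq_INR | easy].
Qed.

Lemma expandable_tail_step f : (forall N, expandable N f) -> forall N,
  expandable N (tail_step f).
Proof.
intros H N; destruct (H (S N)) as [[|c l] [Hl Hf]]; [easy|].
exists l; split; [cbn in Hl; lia|].
unfold tail_step; rewrite (is_lim_seq_unique _ _ (is_lim_expansion _ _ _ Hf)); exact Hf.
Qed.

Lemma expandable_expansion f : (forall N, expandable N f) -> has_asymptotic_expansion f.
Proof.
intros H; exists (fun n => real (Lim_seq (tails n f))).
assert (HE : forall n N, expandable N (tails n f))
  by (induction n as [|n IH]; [exact H | now apply expandable_tail_step]).
intros N; destruct (expandable_bdd 0 _ (HE (S N) 0%nat)) as [C HC]; exists C.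
generalize (filter_and _ _ HC eventually_pos); apply filter_imp; intros b [Hb Hp].
rewrite sum_n_rsum.
assert (Ef : forall n, f b - rsum n (fun n => Lim_seq (tails n f) / INR b ^ n)
  = tails n f b * / INR b ^ n).
{ induction n as [|n IH]; [cbn; field|].
  assert (INR b ^ n <> 0) by (apply pow_nonzero; lra).
  cbn [rsum tails]; unfold tail_step.
  transitivity (tails n f b * / INR b ^ n - Lim_seq (tails n f) / INR b ^ n);
    [rewrite <- IH; ring|]; cbn [pow]; field; lra. }
rewrite Ef, Rabs_mult, Nat.add_1_r.
apply Rmult_le_compat_r; [apply Rabs_pos | easy].
Qed.

(** * Expansions of power sums *)

Lemma rsum_S n f : rsum (S n) f = rsum n f + f n.
Proof. easy. Qed.

Lemma rsum_swap n m (f : nat -> nat -> R) :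
  rsum n (fun i => rsum m (fun j => f i j)) = rsum m (fun j => rsum n (fun i => f i j)).
Proof.
induction n as [|n IH]; cbn [rsum]; [rewrite rsum_const; ring|].
now rewrite IH, <- rsum_plus.
Qed.

Lemma binom_n_n n : Binomial.C n n = 1.
Proof.
unfold Binomial.C; rewrite Nat.sub_diag; cbn [fact INR].
field; apply INR_fact_neq_0.
Qed.

Lemma binom_S_n n : Binomial.C (S n) n = INR (S n).
Proof.
unfold Binomial.C; replace (S n - n)%nat with 1%nat by lia.
replace (fact (S n)) with (S n * fact n)%nat by easy; rewrite mult_INR; cbn [fact].
change (INR (1 * 1)) with 1; field; apply INR_fact_neq_0.
Qed.

(** The power sum [0^i + ... + (b-1)^i]. *)
Definition sigma (i b : nat) : R := rsum b (fun a => INR a ^ i).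

Lemma faulhaber i b :
  INR b ^ S i = rsum (S i) (fun j => Binomial.C (S i) j * sigma j b).
Proof.
unfold sigma.
rewrite (rsum_ext (S i) _ (fun j => rsum b (fun a => Binomial.C (S i) j * INR a ^ j)))
  by (intros; now rewrite rsum_scal).
rewrite <- rsum_swap.
rewrite (rsum_ext b _ (fun a => INR (S a) ^ S i - INR a ^ S i)).
- rewrite (rsum_tele b (fun a => INR a ^ S i)); cbn [INR]; rewrite pow_i by lia; ring.
- intros a _; symmetry; rewrite S_INR, binomial, sum_f_R0_rsum.
  rewrite (rsum_S (S i)), binom_n_n, pow1,
    (rsum_ext (S i) _ (fun j => Binomial.C (S i) j * INR a ^ j));
    [ring|]; intros; rewrite pow1; ring.
Qed.

(** The normalized power sum [(0^i + ... + (b-1)^i) / b^(i+1)]. *)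
Definition psum (i b : nat) : R := sigma i b * / INR b ^ S i.

Lemma expandable_psum i N : expandable N (psum i).
Proof.
induction i as [i IH] using lt_wf_ind.
apply expandable_ext with (fun b => / INR (S i) * (1 - rsum i (fun j =>
  Binomial.C (S i) j * (psum j b * (/ INR b) ^ (i - j))))).
- generalize eventually_pos; apply filter_imp; intros b Hb.
  assert (Hi : INR (S i) <> 0) by (apply not_0_INR; lia).
  assert (Hp : forall n, INR b ^ n <> 0) by (intros; apply pow_nonzero; lra).
  pose proof (faulhaber i b) as F; cbn [rsum] in F; rewrite binom_S_n in F.
  rewrite (rsum_ext i _ (fun j => / INR b ^ S i * (Binomial.C (S i) j * sigma j b))).
  + rewrite rsum_scal; unfold psum.
    replace (rsum i (fun j => Binomial.C (S i) j * sigma j b))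
      with (INR b ^ S i - INR (S i) * sigma i b) by lra.
    field; auto.
  + intros j Hj; unfold psum; rewrite pow_inv.
    replace (INR b ^ S i) with (INR b ^ S j * INR b ^ (i - j))
      by (rewrite <- pow_add; f_equal; lia).
    field; auto.
- apply expandable_scal, expandable_minus; [apply expandable_const|];
  apply expandable_rsum; intros j Hj.
  apply expandable_scal, expandable_mult; [now apply IH | apply expandable_inv_pow].
Qed.

(** [poch p v = v (v + 1) ... (v + p - 1)]. *)
Fixpoint poch (p : nat) (v : R) : R :=
  match p with O => 1 | S p => poch p v * (v + INR p) end.

Lemma poch_S_l p v : poch (S p) v = v * poch p (v + 1).
Proof.
induction p as [|p IH]; [cbn; ring|].
change (poch (S (S p)) v) with (poch (S p) v * (v + INR (S p))).
rewrite IH, S_INR; cbn [poch]; ring.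
Qed.

Lemma poch_ge p u v : 0 < u <= v -> u ^ p <= poch p v.
Proof.
intros H; induction p as [|p IH]; cbn [poch pow]; [lra|].
rewrite Rmult_comm; pose proof (pos_INR p).
apply Rmult_le_compat; try lra; apply pow_le; lra.
Qed.

Lemma poch_pos p v : 0 < v -> 0 < poch p v.
Proof.
intros H; pose proof (poch_ge p v v ltac:(lra)); pose proof (pow_lt v p H); lra.
Qed.

(** The sum of [1 / (v ^ s * poch p v)] over [d b <= v < (d + 1) b]. It
    telescopes for [s = 0]; trading a factor [1 / v] for [1 / (v + p)] costs a
    sum of the same shape and of higher degree. *)
Definition inv_sum (d s p b : nat) : R :=
  rsum b (fun a => / (INR (d * b + a) ^ s * poch p (INR (d * b + a)))).

Section PowerSums.
Context (d : nat) (Hd0 : (0 < d)%nat).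

Lemma arg_ge b a : INR b <= INR (d * b + a).
Proof. apply le_INR; nia. Qed.

Lemma inv_sum_step s p b : (0 < b)%nat ->
  inv_sum d (S s) p b = inv_sum d s (S p) b + INR p * inv_sum d (S s) (S p) b.
Proof.
intros Hb; unfold inv_sum; rewrite <- rsum_scal, <- rsum_plus; apply rsum_ext;
  intros a _.
assert (H : 0 < INR (d * b + a)) by (apply lt_0_INR; nia).
set (v := INR (d * b + a)) in *; cbn [poch pow].
pose proof (poch_pos p v H); pose proof (pow_lt v s H); pose proof (pos_INR p).
field; lra.
Qed.

Lemma inv_sum_tele p b : (0 < b)%nat ->
  inv_sum d 0 (S (S p)) b = / INR (S p) *
    (/ poch (S p) (INR d * INR b) - / poch (S p) ((INR d + 1) * INR b)).
Proof.
intros Hb; unfold inv_sum.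
rewrite (rsum_ext b _ (fun a => / INR (S p) *
  (- / poch (S p) (INR d * INR b + INR (S a)) -
    - / poch (S p) (INR d * INR b + INR a)))).
- rewrite rsum_scal, (rsum_tele b (fun a => - / poch (S p) (INR d * INR b + INR a))).
  cbn [INR]; rewrite Rplus_0_r, Rmult_plus_distr_r, Rmult_1_l; ring.
- intros a _; assert (H : 0 < INR (d * b + a)) by (apply lt_0_INR; nia).
  rewrite (S_INR a), <- Rplus_assoc, <- mult_INR, <- plus_INR.
  set (v := INR (d * b + a)) in *.
  assert (H1 : 0 < v + 1) by lra.
  pose proof (poch_pos p _ H1); pose proof (pos_INR p).
  rewrite Rmult_1_l.
  replace (poch (S (S p)) v) with (v * (poch p (v + 1) * (v + 1 + INR p)))
    by (rewrite poch_S_l; easy).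
  rewrite (poch_S_l p v); cbn [poch]; rewrite S_INR.
  field; repeat split; lra.
Qed.

Lemma bdd_inv_sum s p : (2 <= s + p)%nat ->
  bdd (fun b => INR b ^ (s + p - 1) * inv_sum d s p b).
Proof.
intros Hsp; exists 1, 1%nat; intros b Hb.
assert (Hb' : 0 < INR b) by (apply lt_0_INR; lia).
assert (Hpb : forall n, 0 < INR b ^ n) by (intros; now apply pow_lt).
assert (HX : 0 <= inv_sum d s p b <= INR b * / INR b ^ (s + p)).
{ unfold inv_sum; rewrite <- rsum_const; split.
  - replace 0 with (rsum b (fun _ => 0)) by (rewrite rsum_const; ring).
    apply rsum_le; intros a _; pose proof (arg_ge b a).
    left; apply Rinv_0_lt_compat, Rmult_lt_0_compat;
      [apply pow_lt | apply poch_pos]; lra.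
  - apply rsum_le; intros a _; pose proof (arg_ge b a).
    apply Rinv_le_contravar; [easy|]; rewrite pow_add.
    apply Rmult_le_compat; try (left; easy).
    + apply pow_incr; lra.
    + apply poch_ge; lra. }
rewrite Rabs_pos_eq by (apply Rmult_le_pos; [left|]; easy).
replace 1 with (INR b ^ (s + p - 1) * (INR b * / INR b ^ (s + p))).
- apply Rmult_le_compat_l; [left|]; easy.
- replace (s + p)%nat with (S (s + p - 1)) at 2 by lia; cbn [pow].
  specialize (Hpb (s + p - 1)%nat); field; lra.
Qed.

Lemma expandable_poch_inv N p e : 0 < e ->
  expandable N (fun b => INR b ^ p * / poch p (e * INR b)).
Proof.
intros He; induction p as [|p IH].
- apply expandable_ext_all with (fun _ => 1);
  [intros; cbn; field | apply expandable_const].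
- apply expandable_ext with (fun b => (INR b ^ p * / poch p (e * INR b))
    * (INR b * / (e * INR b + INR p))).
  + generalize eventually_pos; apply filter_imp; intros b Hb; cbn [poch pow].
    assert (0 < e * INR b) by nra; pose proof (pos_INR p).
    pose proof (poch_pos p (e * INR b) ltac:(lra)); field; lra.
  + apply expandable_mult; [easy|].
    apply (expandable_div N (fun b => e + INR p * / INR b) _ e); [lra| |].
    * apply expandable_ext with (fun _ => INR p); [|apply expandable_const].
      generalize eventually_pos; apply filter_imp; intros b Hb; field; lra.
    * apply expandable_ext with (fun _ => 1); [|apply expandable_const].
      generalize eventually_pos; apply filter_imp; intros b Hb.
      assert (0 < e * INR b) by nra; pose proof (pos_INR p); field; lra.
Qed.

(** Induction on the number [N] of coefficients: in [inv_sum_step] the second sum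
    carries an additional factor [1 / b], so that [N] coefficients of it give
    [N + 1] coefficients of the product; the first sum has a smaller [s]. *)
Lemma expandable_inv_sum N : forall s p, (2 <= s + p)%nat ->
  expandable N (fun b => INR b ^ (s + p - 1) * inv_sum d s p b).
Proof.
induction N as [|N IHN]; intros s; [intros; now apply expandable_0, bdd_inv_sum|].
induction s as [|s IHs]; intros p Hp.
- destruct p as [|[|p]]; [lia|lia|].
  assert (HdR : 0 < INR d) by now apply lt_0_INR.
  apply expandable_ext with (fun b => / INR (S p) *
    (INR b ^ S p * / poch (S p) (INR d * INR b)
     - INR b ^ S p * / poch (S p) ((INR d + 1) * INR b))).
  + generalize (eventually_ge 1); apply filter_imp; intros b Hb.
    rewrite inv_sum_tele by lia; change (0 + S (S p) - 1)%nat with (S p); ring.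
  + apply expandable_scal, expandable_minus; apply expandable_poch_inv; lra.
- apply expandable_ext with (fun b => INR b ^ (s + S p - 1) * inv_sum d s (S p) b
    + INR p * ((INR b ^ (S s + S p - 1) * inv_sum d (S s) (S p) b) / INR b)).
  + generalize (eventually_ge 1); apply filter_imp; intros b Hb.
    assert (0 < INR b) by (apply lt_0_INR; lia).
    rewrite (inv_sum_step s p b) by lia.
    replace (S s + S p - 1)%nat with (S (s + S p - 1)) by lia.
    replace (S s + p - 1)%nat with (s + S p - 1)%nat by lia.
    cbn [pow]; field; lra.
  + apply expandable_plus; [apply IHs; lia|]; apply expandable_scal, expandable_over_b,
    IHN; lia.
Qed.

End PowerSums.

(** * Expansions of the moments *)

Lemma eventually_base d : eventually (fun b => (2 <= b)%nat /\ (d < b)%nat).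
Proof. exists (2 + d)%nat; lia. Qed.

Section Moments.
Context (d : nat).

(** The contribution of the strings that begin with [d] to [nu_pow_step]; for [k = 0]
    only Lebesgue measure contributes. *)
Definition head_moment (k m b : nat) : R :=
  match k with
  | O => - (INR b * ((INR d + 1) ^ S m / INR (S m) - INR d ^ S m / INR (S m)))
  | S k' => nu_pow b d k' (INR d) m
  end.

Lemma nu_pow_binomial_S b k c m : (2 <= b)%nat -> (d < b)%nat -> 0 <= c ->
  nu_pow b d k c (S m) = rsum (S m) (fun i =>
    Binomial.C (S m) (S i) * c ^ (m - i) * nu_pow b d k 0 (S i)).
Proof.
intros Hb Hd Hc; rewrite nu_pow_binomial by easy; rewrite rsum_S_l, nu_pow_0 by easy.
rewrite Rmult_0_r, Rplus_0_l; apply rsum_ext; intros i _; easy.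
Qed.

(** The linear recurrence for the moments, solved for the highest one. *)
Lemma nu_pow_rec k m b : (2 <= b)%nat -> (d < b)%nat ->
  (INR b ^ S (S m) - INR b + 1) * nu_pow b d k 0 (S m)
  = rsum m (fun i => Binomial.C (S m) (S i)
      * (sigma (m - i) b - INR d ^ (m - i)) * nu_pow b d k 0 (S i))
    + head_moment k (S m) b.
Proof.
intros Hb Hd; pose proof (nu_pow_step b d Hb Hd k (S m) ltac:(lia)) as H.
fold (head_moment k (S m) b) in H.
rewrite (rsum_ext b _ (fun a => rsum (S m) (fun i =>
    Binomial.C (S m) (S i) * INR a ^ (m - i) * nu_pow b d k 0 (S i)))) in H
  by (intros; apply nu_pow_binomial_S; auto using pos_INR).
rewrite rsum_swap, (nu_pow_binomial_S b k (INR d)) in H by (easy || apply pos_INR).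
rewrite (rsum_ext (S m) _ (fun i => Binomial.C (S m) (S i) * sigma (m - i) b
    * nu_pow b d k 0 (S i))) in H.
2:{ intros i _; unfold sigma.
    rewrite (rsum_ext b _ (fun a => Binomial.C (S m) (S i) * nu_pow b d k 0 (S i)
      * INR a ^ (m - i))) by (intros; ring).
    rewrite rsum_scal; ring. }
rewrite <- rsum_minus in H; cbn [rsum] in H.
rewrite binom_n_n, Nat.sub_diag in H.
replace (sigma 0 b) with (INR b) in H
  by (unfold sigma; cbn [pow]; rewrite rsum_const; ring).
rewrite (rsum_ext m _ (fun i => Binomial.C (S m) (S i)
      * (sigma (m - i) b - INR d ^ (m - i)) * nu_pow b d k 0 (S i))) in H
  by (intros; ring).
rewrite pow_O in H; lra.
Qed.

Lemma expandable_den N m (g : nat -> R) :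
  expandable N (fun b => (1 - (/ INR b) ^ S m + (/ INR b) ^ S (S m)) * g b) ->
    expandable N g.
Proof.
apply (expandable_div N _ g 1); [lra|].
apply expandable_ext with (fun b => - (/ INR b) ^ m + (/ INR b) ^ S m).
- generalize eventually_pos; apply filter_imp; intros b Hb; cbn [pow]; field; lra.
- apply expandable_plus; [apply expandable_opp|]; apply expandable_inv_pow.
Qed.

(** For fixed [k] the recurrence is solved by induction on the degree of the
    moment; the factor of the highest moment tends to [1] after division by
    [b ^ (m + 2)]. *)
Lemma expandable_moments_step N k :
  (forall m, expandable N (fun b => INR b ^ (2 * k) * head_moment k (S m) b / INR b)) ->
  expandable N (fun b => INR b ^ (2 * k + 1) * nu_pow b d k 0 1) /\
  forall m, expandable N (fun b => INR b ^ (2 * k + 2) * nu_pow b d k 0 (S (S m))).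
Proof.
intros Hprev.
assert (H1 : expandable N (fun b => INR b ^ (2 * k + 1) * nu_pow b d k 0 1)).
{ apply (expandable_den N 0), expandable_ext with (2 := Hprev 0%nat).
  generalize (filter_and _ _ (eventually_base d) eventually_pos).
  apply filter_imp; intros b [[Hb Hd] Hp].
  pose proof (nu_pow_rec k 0 b Hb Hd) as H; cbn [rsum] in H; rewrite Rplus_0_l in H.
  rewrite <- H, pow_add; cbn [pow]; field; lra. }
split; [exact H1|].
induction m as [m IH] using lt_wf_ind; apply (expandable_den N (S m)).
apply expandable_ext with (fun b =>
  rsum m (fun i => Binomial.C (S (S m)) (S (S i))
    * (psum (m - i) b * (/ INR b) ^ (S (S i))
      - INR d ^ (m - i) * (/ INR b) ^ (S (S (S m))))
    * (INR b ^ (2 * k + 2) * nu_pow b d k 0 (S (S i))))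
  + Binomial.C (S (S m)) 1 * (psum (S m) b - INR d ^ (S m) * (/ INR b) ^ (S (S m)))
    * (INR b ^ (2 * k + 1) * nu_pow b d k 0 1)
  + (/ INR b) ^ m * (INR b ^ (2 * k) * head_moment k (S (S m)) b / INR b)).
- generalize (filter_and _ _ (eventually_base d) eventually_pos).
  apply filter_imp; intros b [[Hb Hd] Hp].
  assert (Hn : forall n, INR b ^ n <> 0) by (intros; apply pow_nonzero; lra).
  pose proof (nu_pow_rec k (S m) b Hb Hd) as H; rewrite rsum_S_l, Nat.sub_0_r in H.
  transitivity (INR b ^ (2 * k + 2) * / INR b ^ S (S (S m)) *
    ((INR b ^ S (S (S m)) - INR b + 1) * nu_pow b d k 0 (S (S m)))).
  + rewrite H, !Rmult_plus_distr_l, <- rsum_scal.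
    rewrite (Rplus_comm (rsum m _)); f_equal; [f_equal|].
    * unfold psum; rewrite !pow_add, !pow_inv; cbn [pow]; field; auto using Rgt_not_eq.
    * apply rsum_ext; intros i Hi; unfold psum; rewrite Nat.sub_succ, !pow_inv.
      replace (S (S (S m))) with (S (m - i) + S (S i))%nat by lia.
      rewrite (pow_add _ (S (m - i))); field; auto.
    * rewrite !pow_add, !pow_inv; cbn [pow]; field; auto using Rgt_not_eq.
  + rewrite !pow_inv; cbn [pow]; field; auto using Rgt_not_eq.
- repeat apply expandable_plus.
  + apply expandable_rsum; intros i Hi; apply expandable_mult; [|now apply IH].
    apply expandable_scal, expandable_minus;
      [|apply expandable_scal, expandable_inv_pow].
    apply expandable_mult; [apply expandable_psum | apply expandable_inv_pow].
  + apply expandable_mult; [|exact H1]; apply expandable_scal, expandable_minus;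
    [apply expandable_psum|].
    apply expandable_scal, expandable_inv_pow.
  + apply expandable_mult; [apply expandable_inv_pow | apply Hprev].
Qed.

(** The moments about a fixed [- c] are combinations of those about [0], so that
    they are [O (b ^ -(2 k + 1))]. *)
Lemma expandable_shifted N k c :
  expandable N (fun b => INR b ^ (2 * k + 1) * nu_pow b d k 0 1) /\
  (forall m, expandable N (fun b => INR b ^ (2 * k + 2) * nu_pow b d k 0 (S (S m)))) ->
  0 <= c -> forall m, expandable N (fun b =>
    INR b ^ (2 * k + 1) * nu_pow b d k c (S m)).
Proof.
intros [H1 H2] Hc m.
apply expandable_ext with (fun b =>
  rsum (S m) (fun i => Binomial.C (S m) (S i) * c ^ (m - i)
  * (INR b ^ (2 * k + 1) * nu_pow b d k 0 (S i)))).
- generalize (eventually_base d); apply filter_imp; intros b [Hb Hd].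
  rewrite nu_pow_binomial_S, <- rsum_scal by easy; apply rsum_ext; intros; ring.
- apply expandable_rsum; intros [|i] _; apply expandable_scal; [exact H1|].
  apply expandable_ext with (fun b =>
    / INR b * (INR b ^ (2 * k + 2) * nu_pow b d k 0 (S (S i)))).
  + generalize eventually_pos; apply filter_imp; intros b Hb.
    rewrite !pow_add; cbn [pow]; field; lra.
  + apply expandable_mult; [apply expandable_inv | apply H2].
Qed.

(** The first moment is [O (b ^ -(2 k + 1))], the higher ones are
    [O (b ^ -(2 k + 2))]. *)
Lemma expandable_moments N k :
  expandable N (fun b => INR b ^ (2 * k + 1) * nu_pow b d k 0 1) /\
  forall m, expandable N (fun b => INR b ^ (2 * k + 2) * nu_pow b d k 0 (S (S m))).
Proof.
induction k as [|k IHk]; apply expandable_moments_step; intros m.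
- apply expandable_ext with (fun _ => - ((INR d + 1) ^ S (S m) / INR (S (S m))
    - INR d ^ S (S m) / INR (S (S m)))); [|apply expandable_const].
  generalize eventually_pos; apply filter_imp; intros b Hb;
    cbn [head_moment Nat.mul Nat.add].
  rewrite pow_O; field; split; [apply not_0_INR; lia | lra].
- apply expandable_ext with (2 := expandable_shifted N k (INR d) IHk (pos_INR d) m).
  generalize eventually_pos; apply filter_imp; intros b Hb; cbn [head_moment].
  replace (2 * S k)%nat with (S (2 * k + 1)) by lia; cbn [pow]; field; lra.
Qed.

Lemma expandable_nu_pow N k c m : 0 <= c ->
  expandable N (fun b => nu_pow b d k c (S m)).
Proof.
intros Hc; apply expandable_ext with (fun b => (/ INR b) ^ (2 * k + 1)
  * (INR b ^ (2 * k + 1) * nu_pow b d k c (S m))).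
- generalize eventually_pos; apply filter_imp; intros b Hb; rewrite pow_inv.
  field; apply pow_nonzero; lra.
- apply expandable_mult; [apply expandable_inv_pow|]; apply expandable_shifted;
  [apply expandable_moments | easy].
Qed.

End Moments.

(** * The expansion to all orders *)

(** First and second differences of the moments, as for [nu_recip_d1] and
    [nu_recip_d2]. *)
Definition nu_pow_d1 (d : nat) (c : R) (j b : nat) : R := nu_pow b d 1 c j
  - nu_pow b d 2 c j.
Definition nu_pow_d2 (d : nat) (c : R) (j b : nat) : R :=
  nu_pow b d 0 c j - 2 * nu_pow b d 1 c j + nu_pow b d 2 c j.

Lemma is_series_rsum n (f : nat -> nat -> R) (l : nat -> R) :
  (forall j, (j < n)%nat -> is_series (f j) (l j)) ->
  is_series (fun i => rsum n (fun j => f j i)) (rsum n l).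
Proof.
induction n as [|n IH]; intros H; cbn [rsum].
- apply (is_lim_seq_ext (fun _ => 0) _ 0); [|apply is_lim_seq_const].
  intros i; rewrite sum_n_rsum, rsum_const; ring.
- apply (@is_series_plus R_AbsRing R_NormedModule); auto.
Qed.

Lemma Series_close f g h0 : ex_series f -> ex_series g -> ex_series h0 ->
  (forall i, Rabs (f i - g i) <= h0 i) -> Rabs (Series f - Series g) <= Series h0.
Proof.
intros Hf Hg Hh H; rewrite <- Series_minus by easy.
eapply Rle_trans; [apply Series_Rabs|].
- apply (@ex_series_le R_AbsRing R_CompleteNormedModule _ h0); [|easy].
  intros i; cbv [norm]; cbn; unfold abs; cbn; rewrite Rabs_Rabsolu; auto.
- apply Series_le; [|easy]; intros i; split; [apply Rabs_pos | auto].
Qed.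

(** The three terms of [exact_formula] are expanded by [nu_recip_expand], with the
    remainder summed over the index of summation. The moment of degree [0]
    vanishes, so that the harmonic series does not occur. *)
Section Truncation.
Context (b d : nat) (Hb : (2 <= b)%nat) (Hd : (d < b)%nat) (Hd0 : (0 < d)%nat) (n :
  nat).

Lemma nu_recip_expand_S k M c : 0 < M -> 0 <= c ->
  Rabs (nu_recip b d k (M + c)
    - rsum n (fun j => (-1) ^ S j * / M ^ S (S j) * nu_pow b d k c (S j)))
  <= 2 * INR b * ((c + 1) ^ S n / M ^ S (S n)).
Proof.
intros HM Hc; pose proof (nu_recip_expand b d Hb Hd k M c (S n) HM Hc) as H.
rewrite rsum_S_l, nu_pow_0, Rmult_0_r, Rplus_0_l in H by easy; exact H.
Qed.

Lemma nu_recip_d1_expand M c : 0 < M -> 0 <= c ->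
  Rabs (nu_recip_d1 b d (M + c)
    - rsum n (fun j => (-1) ^ S j * / M ^ S (S j) * nu_pow_d1 d c (S j) b))
  <= 4 * INR b * ((c + 1) ^ S n / M ^ S (S n)).
Proof.
intros HM Hc; pose proof (nu_recip_expand_S 1 M c HM Hc) as H1.
pose proof (nu_recip_expand_S 2 M c HM Hc) as H2.
unfold nu_recip_d1, nu_pow_d1; rewrite (rsum_ext n _ (fun j =>
  (-1) ^ S j * / M ^ S (S j) * nu_pow b d 1 c (S j)
  - (-1) ^ S j * / M ^ S (S j) * nu_pow b d 2 c (S j))) by (intros; ring).
rewrite rsum_minus; apply Rabs_le_between in H1, H2; apply Rabs_le; lra.
Qed.

Lemma nu_recip_d2_expand M c : 0 < M -> 0 <= c ->
  Rabs (nu_recip_d2 b d (M + c)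
    - rsum n (fun j => (-1) ^ S j * / M ^ S (S j) * nu_pow_d2 d c (S j) b))
  <= 8 * INR b * ((c + 1) ^ S n / M ^ S (S n)).
Proof.
intros HM Hc; pose proof (nu_recip_expand_S 0 M c HM Hc) as H0.
pose proof (nu_recip_expand_S 1 M c HM Hc) as H1.
pose proof (nu_recip_expand_S 2 M c HM Hc) as H2.
unfold nu_recip_d2, nu_pow_d2; rewrite (rsum_ext n _ (fun j =>
  (-1) ^ S j * / M ^ S (S j) * nu_pow b d 0 c (S j)
  - 2 * ((-1) ^ S j * / M ^ S (S j) * nu_pow b d 1 c (S j))
  + (-1) ^ S j * / M ^ S (S j) * nu_pow b d 2 c (S j))) by (intros; ring).
rewrite rsum_plus, rsum_minus, rsum_scal.
apply Rabs_le_between in H0, H1, H2; apply Rabs_le; lra.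
Qed.

Let b_gt0 : 0 < INR b := b_pos b Hb.

Lemma truncate_series :
  Rabs (Series (fun i => nu_recip_d1 b d (INR (S i * b + d)))
    - rsum n (fun j => (-1) ^ S j * (/ INR b) ^ S (S j) * zeta (S (S j))
        * nu_pow_d1 d (INR d) (S j) b))
  <= 4 * (INR d + 1) ^ S n * zeta (S (S n)) * / INR b ^ S n.
Proof.
assert (Hz : forall s, is_series (fun i => / INR (S i) ^ S (S s)) (zeta (S (S s))))
  by (intros; apply Series_correct, ex_series_inv_pow; lia).
assert (Hpb : forall m, INR b ^ m <> 0) by (intros; apply pow_nonzero; lra).
assert (Hpi : forall i m, INR (S i) ^ m <> 0)
  by (intros; apply pow_nonzero, not_0_INR; lia).
assert (Hpow : forall i m, / (INR (S i) * INR b) ^ m = / INR b ^ m * / INR (S i) ^ m).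
{ intros; rewrite Rpow_mult_distr, Rinv_mult; ring. }
assert (Hg : is_series (fun i => rsum n (fun j =>
    (-1) ^ S j * / (INR (S i) * INR b) ^ S (S j) * nu_pow_d1 d (INR d) (S j) b))
  (rsum n (fun j => (-1) ^ S j * (/ INR b) ^ S (S j) * zeta (S (S j))
        * nu_pow_d1 d (INR d) (S j) b))).
{ apply (is_series_rsum n (fun j i =>
    (-1) ^ S j * / (INR (S i) * INR b) ^ S (S j) * nu_pow_d1 d (INR d) (S j) b)).
  intros j _.
  assert (H : is_series (fun i => (-1) ^ S j * (/ INR b) ^ S (S j)
      * nu_pow_d1 d (INR d) (S j) b * / INR (S i) ^ S (S j))
    ((-1) ^ S j * (/ INR b) ^ S (S j) * nu_pow_d1 d (INR d) (S j) b * zeta (S (S j))))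
    by exact (@is_series_scal R_AbsRing R_NormedModule _ _ _ (Hz j)).
  replace ((-1) ^ S j * (/ INR b) ^ S (S j) * zeta (S (S j)) * nu_pow_d1 d (INR d)
    (S j) b)
    with ((-1) ^ S j * (/ INR b) ^ S (S j) * nu_pow_d1 d (INR d) (S j) b * zeta
      (S (S j)))
    by ring.
  revert H; apply is_series_ext; intros i; rewrite Hpow, pow_inv.
  match goal with |- @eq _ ?x ?y => change (@eq R x y) end; ring. }
assert (Hh : is_series
    (fun i => 4 * (INR d + 1) ^ S n * / INR b ^ S n * / INR (S i) ^ S (S n))
    (4 * (INR d + 1) ^ S n * / INR b ^ S n * zeta (S (S n))))
  by exact (@is_series_scal R_AbsRing R_NormedModule _ _ _ (Hz n)).
rewrite <- (is_series_unique _ _ Hg).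
replace (4 * (INR d + 1) ^ S n * zeta (S (S n)) * / INR b ^ S n)
  with (4 * (INR d + 1) ^ S n * / INR b ^ S n * zeta (S (S n))) by ring.
rewrite <- (is_series_unique _ _ Hh).
apply Series_close.
- eexists; apply is_series_nu_recip_d1; easy.
- eexists; exact Hg.
- eexists; exact Hh.
- intros i.
  assert (Hi : 0 < INR (S i)) by (apply lt_0_INR; lia).
  rewrite plus_INR, mult_INR; eapply Rle_trans.
  + apply nu_recip_d1_expand; [nra | apply pos_INR].
  + right; unfold Rdiv; rewrite Hpow.
    replace (INR b ^ S (S n)) with (INR b * INR b ^ S n) by easy.
    specialize (Hpb (S n)); specialize (Hpi i (S (S n))); field; repeat split; lra.
Qed.

Lemma truncate_block_sum :
  Rabs (rsum b (fun a => nu_recip_d1 b d (INR (d * b + a)))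
    - rsum n (fun j => (-1) ^ S j * inv_sum d (S (S j)) 0 b * nu_pow_d1 d 0 (S j) b))
  <= 4 * / INR b ^ n.
Proof.
assert (Hpb : INR b ^ n <> 0) by (apply pow_nonzero; lra).
assert (E1 : rsum n (fun j =>
  (-1) ^ S j * inv_sum d (S (S j)) 0 b * nu_pow_d1 d 0 (S j) b)
  = rsum b (fun a => rsum n (fun j =>
      (-1) ^ S j * / INR (d * b + a) ^ S (S j) * nu_pow_d1 d 0 (S j) b))).
{ rewrite rsum_swap; apply rsum_ext; intros j _; unfold inv_sum.
  rewrite (rsum_ext b (fun a =>
    (-1) ^ S j * / INR (d * b + a) ^ S (S j) * nu_pow_d1 d 0 (S j) b)
    (fun a => (-1) ^ S j * nu_pow_d1 d 0 (S j) b * (/ (INR (d * b + a) ^ S (S j)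
       * poch 0 (INR (d * b + a)))))) by (intros; cbn [poch]; rewrite Rmult_1_r; ring).
  rewrite rsum_scal; ring. }
rewrite E1, <- rsum_minus; eapply Rle_trans; [apply rsum_abs|].
apply Rle_trans with (rsum b (fun _ => 4 * INR b * / INR b ^ S (S n))).
- apply rsum_le; intros a _; pose proof (arg_ge d Hd0 b a).
  rewrite <- (Rplus_0_r (INR (d * b + a))) at 1.
  eapply Rle_trans; [apply nu_recip_d1_expand; lra|].
  rewrite Rplus_0_l, pow1, Rdiv_1_l; apply Rmult_le_compat_l; [lra|].
  apply Rinv_le_contravar; [now apply pow_lt | apply pow_incr; lra].
- rewrite rsum_const; right; cbn [pow]; field; lra.
Qed.

Lemma truncate_last_term :
  Rabs (nu_recip_d2 b d (INR (d * b + d))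
    - rsum n (fun j => (-1) ^ S j * / (INR d * INR b) ^ S (S j) * nu_pow_d2 d (INR d)
      (S j) b))
  <= 8 * (INR d + 1) ^ S n * / INR b ^ S n.
Proof.
assert (Hpb : 0 < INR b ^ S n) by now apply pow_lt.
assert (H1 : 1 <= INR d) by (apply (le_INR 1); lia).
rewrite plus_INR, mult_INR; eapply Rle_trans.
- apply nu_recip_d2_expand; [nra | apply pos_INR].
- apply Rle_trans with (8 * INR b * ((INR d + 1) ^ S n / INR b ^ S (S n))).
  + apply Rmult_le_compat_l; [lra|]; apply Rmult_le_compat_l; [apply pow_le; lra|].
    apply Rinv_le_contravar; [now apply pow_lt | apply pow_incr; nra].
  + right; replace (INR b ^ S (S n)) with (INR b * INR b ^ S n) by easy; field; lra.
Qed.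

End Truncation.

(** The expansion, truncated after [n] moments. *)
Definition main_part (d n b : nat) : R :=
  rsum n (fun j => (-1) ^ S j *
    ((/ INR b) ^ S (S j) * zeta (S (S j)) * nu_pow_d1 d (INR d) (S j) b
     + inv_sum d (S (S j)) 0 b * nu_pow_d1 d 0 (S j) b
     + / (INR d * INR b) ^ S (S j) * nu_pow_d2 d (INR d) (S j) b)).

(** The quantity to be expanded. *)
Definition deviation (d b : nat) : R := digit_harmonic_sum b d 2 - INR b * ln (INR b).

Lemma deviation_main_part d n : (0 < d)%nat ->
  bdd (fun b => INR b ^ n * (deviation d b - main_part d n b)).
Proof.
intros Hd0.
exists (4 * (INR d + 1) ^ S n * zeta (S (S n)) + 4 + 8 * (INR d + 1) ^ S n).
generalize (filter_and _ _ (eventually_base d) (eventually_ge 1)).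
apply filter_imp; intros b [[Hb Hd] Hb1].
assert (Hp : 0 < INR b) by (apply lt_0_INR; lia).
assert (Hpn : 0 < INR b ^ n) by now apply pow_lt.
pose proof (truncate_series b d Hb Hd Hd0 n) as T1.
pose proof (truncate_block_sum b d Hb Hd Hd0 n) as T2.
pose proof (truncate_last_term b d Hb Hd Hd0 n) as T3.
assert (Hz : 0 <= zeta (S (S n))).
{ unfold zeta; rewrite <- (Rmult_0_l (Series (fun _ => 0))), <- Series_scal_l.
  apply Series_le; [|apply ex_series_inv_pow; lia].
  intros i; rewrite Rmult_0_l; split; [lra|].
  left; apply Rinv_0_lt_compat, pow_lt, lt_0_INR; lia. }
assert (Hd1 : 0 <= (INR d + 1) ^ S n) by (apply pow_le; pose proof (pos_INR d); lra).
assert (Hw : / INR b ^ S n <= / INR b ^ n).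
{ apply Rinv_le_contravar; [easy|]; cbn [pow].
  assert (1 <= INR b) by (now apply (le_INR 1)); nra. }
assert (Em : main_part d n b =
  rsum n (fun j => (-1) ^ S j * (/ INR b) ^ S (S j) * zeta (S (S j))
        * nu_pow_d1 d (INR d) (S j) b)
  + rsum n (fun j => (-1) ^ S j * inv_sum d (S (S j)) 0 b * nu_pow_d1 d 0 (S j) b)
  + rsum n (fun j => (-1) ^ S j * / (INR d * INR b) ^ S (S j) * nu_pow_d2 d (INR d)
    (S j) b)).
{ unfold main_part; rewrite <- !rsum_plus; apply rsum_ext; intros; ring. }
unfold deviation; rewrite Em, exact_formula by easy.
rewrite Rabs_mult, (Rabs_pos_eq (INR b ^ n)) by lra.
apply (Rmult_le_reg_l (/ INR b ^ n)); [now apply Rinv_0_lt_compat|].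
rewrite <- Rmult_assoc, Rinv_l, Rmult_1_l by lra.
apply Rabs_le_between in T1, T2, T3.
assert (Hm : forall c, 0 <= c -> c * / INR b ^ S n <= c * / INR b ^ n)
  by (intros; now apply Rmult_le_compat_l).
pose proof (Hm (4 * (INR d + 1) ^ S n * zeta (S (S n))) ltac:(nra)).
pose proof (Hm (8 * (INR d + 1) ^ S n) ltac:(nra)).
apply Rabs_le; lra.
Qed.

Lemma expandable_nu_pow_d1 N d c j : 0 <= c -> expandable N (nu_pow_d1 d c (S j)).
Proof. intros; apply expandable_minus; now apply expandable_nu_pow. Qed.

Lemma expandable_nu_pow_d2 N d c j : 0 <= c -> expandable N (nu_pow_d2 d c (S j)).
Proof. intros; apply expandable_plus;
  [apply expandable_minus; [|apply expandable_scal]|]; now apply expandable_nu_pow. Qed.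

(** Any function that is [O (b ^ -N)] has [N] zero coefficients. *)
Lemma expandable_small N f : bdd (fun b => INR b ^ N * f b) -> expandable N f.
Proof.
revert f; induction N as [|N IH]; intros f H.
- apply expandable_0; revert H; apply bdd_ext, filter_forall; intros; cbn; ring.
- apply expandable_ext with (fun b => (INR b * f b) / INR b).
  + generalize eventually_pos; apply filter_imp; intros b Hb; field; lra.
  + apply expandable_over_b, IH; revert H; apply bdd_ext, filter_forall; intros;
    cbn [pow]; ring.
Qed.

Lemma expandable_deviation N d : (0 < d)%nat -> expandable N (deviation d).
Proof.
intros Hd0; assert (Hd : 0 < INR d) by now apply lt_0_INR.
apply expandable_ext_all with (fun b => (deviation d b - main_part d N b)
  + main_part d N b);
  [intros; ring|].
apply expandable_plus; [now apply expandable_small, deviation_main_part|].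
apply expandable_rsum; intros j _; apply expandable_scal; repeat apply expandable_plus.
- apply expandable_mult; [|apply expandable_nu_pow_d1; lra].
  apply expandable_mult; [apply expandable_inv_pow | apply expandable_const].
- apply expandable_mult; [|apply expandable_nu_pow_d1; lra].
  apply expandable_ext with (fun b =>
    (/ INR b) ^ S j * (INR b ^ S j * inv_sum d (S (S j)) 0 b)).
  + generalize eventually_pos; apply filter_imp; intros b Hb; rewrite pow_inv.
    field; apply pow_nonzero; lra.
  + apply expandable_mult; [apply expandable_inv_pow|].
    generalize (expandable_inv_sum d Hd0 N (S (S j)) 0 ltac:(lia));
      apply expandable_ext_all; intros b.
    now replace (S (S j) + 0 - 1)%nat with (S j) by lia.
- apply expandable_mult; [|apply expandable_nu_pow_d2; lra].
  apply expandable_ext with (fun b => (/ INR d) ^ S (S j) * (/ INR b) ^ S (S j)).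
  + generalize eventually_pos; apply filter_imp; intros b Hb.
    now rewrite <- Rpow_mult_distr, <- Rinv_mult, pow_inv.
  + apply expandable_scal, expandable_inv_pow.
Qed.

(** * Recurrences for the first moments *)

Lemma expansion_eq l l' f : l = l' -> expansion l f -> expansion l' f.
Proof. now intros ->. Qed.

Lemma expansion_horner l : expansion l (fun b => horner l (/ INR b)).
Proof.
induction l as [|c l IH]; [exact (bdd_const 0)|].
apply expansion_cons with (2 := IH), filter_forall; intros; cbn; unfold Rdiv; ring.
Qed.

Lemma expansion_nil N f : expandable N f -> expansion [] f.
Proof. apply expandable_bdd. Qed.

(** Equality of two lists of rational expressions of the same length. *)
Ltac list_field :=
  cbn [ladd map lmul ldiv length];
  repeat (apply (f_equal2 (@cons R)); [field; repeat split; lra|]); reflexivity.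

(** [1 - b ^ -(m+1) + b ^ -(m+2)], the normalized factor of the highest moment
    in [nu_pow_rec]. *)
Definition den (m b : nat) : R := 1 - (/ INR b) ^ S m + (/ INR b) ^ S (S m).

Lemma expansion_den0 : expansion [1; -1; 1; 0; 0] (den 0).
Proof.
generalize (expansion_horner [1; -1; 1; 0; 0]); apply expansion_ext, filter_forall;
  intros b.
unfold den; cbn; ring.
Qed.

Lemma expansion_den1 : expansion [1; 0; -1; 1] (den 1).
Proof.
generalize (expansion_horner [1; 0; -1; 1]); apply expansion_ext, filter_forall;
  intros b.
unfold den; cbn; ring.
Qed.

Lemma expansion_den2 : expansion [1; 0; 0; -1; 1] (den 2).
Proof.
generalize (expansion_horner [1; 0; 0; -1; 1]); apply expansion_ext, filter_forall;
  intros b.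
unfold den; cbn; ring.
Qed.

Lemma expansion_den3 : expansion [1; 0; 0; 0; -1; 1] (den 3).
Proof.
generalize (expansion_horner [1; 0; 0; 0; -1; 1]); apply expansion_ext, filter_forall;
  intros b.
unfold den; cbn; ring.
Qed.

Lemma binom_2_1 : Binomial.C 2 1 = 2.
Proof. unfold Binomial.C; cbn; field. Qed.
Lemma binom_3_1 : Binomial.C 3 1 = 3.
Proof. unfold Binomial.C; cbn; field. Qed.
Lemma binom_3_2 : Binomial.C 3 2 = 3.
Proof. unfold Binomial.C; cbn; field. Qed.
Lemma binom_4_1 : Binomial.C 4 1 = 4.
Proof. unfold Binomial.C; cbn; field. Qed.
Lemma binom_4_2 : Binomial.C 4 2 = 6.
Proof. unfold Binomial.C; cbn; field. Qed.
Lemma binom_4_3 : Binomial.C 4 3 = 4.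
Proof. unfold Binomial.C; cbn; field. Qed.
Lemma binom_5_1 : Binomial.C 5 1 = 5.
Proof. unfold Binomial.C; cbn; field. Qed.

Lemma sigma_1 b : sigma 1 b = (INR b ^ 2 - INR b) / 2.
Proof.
unfold sigma; induction b as [|b IH]; cbn [rsum]; [cbn; field|].
rewrite IH, S_INR; field.
Qed.

Lemma sigma_2 b : sigma 2 b = INR b ^ 3 / 3 - INR b ^ 2 / 2 + INR b / 6.
Proof.
unfold sigma; induction b as [|b IH]; cbn [rsum]; [cbn; field|].
rewrite IH, S_INR; field.
Qed.

Lemma sigma_3 b : sigma 3 b = (INR b ^ 2 - INR b) ^ 2 / 4.
Proof.
unfold sigma; induction b as [|b IH]; cbn [rsum]; [cbn; field|].
rewrite IH, S_INR; field.
Qed.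

Section Coefficients.
Context (d : nat).
Notation D := (INR d).

(** Normalized moments: the first one, the higher ones, and those about [- d]. *)
Definition first_moment (k b : nat) : R := INR b ^ (2 * k + 1) * nu_pow b d k 0 1.
Definition higher_moment (k m b : nat) : R := INR b ^ (2 * k + 2) * nu_pow b d k 0 m.
Definition shifted_moment (k m b : nat) : R := INR b ^ (2 * k + 1) * nu_pow b d k D m.

Lemma expandable_higher_moment N k m : expandable N (higher_moment k (S (S m))).
Proof. apply expandable_moments. Qed.

Lemma expandable_shifted_moment N k m : expandable N (shifted_moment k (S m)).
Proof. apply expandable_shifted; [apply expandable_moments | apply pos_INR]. Qed.

Lemma eventually_base_pos :
  eventually (fun b => (2 <= b)%nat /\ (d < b)%nat /\ 0 < INR b).
Proof.
generalize (filter_and _ _ (eventually_base d) eventually_pos).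
apply filter_imp; intros b [[H1 H2] H3]; easy.
Qed.

Lemma shifted_moment_1 k :
  eventually (fun b => shifted_moment k 1 b = first_moment k b).
Proof.
generalize eventually_base_pos; apply filter_imp; intros b (Hb & Hd & Hp).
unfold shifted_moment, first_moment; rewrite nu_pow_binomial_S
  by (easy || apply pos_INR); cbn [rsum Nat.sub pow].
rewrite binom_n_n; ring.
Qed.

Lemma shifted_moment_2 k :
  eventually (fun b => shifted_moment k 2 b = 2 * D * first_moment k b
  + higher_moment k 2 b / INR b).
Proof.
generalize eventually_base_pos; apply filter_imp; intros b (Hb & Hd & Hp).
unfold shifted_moment, first_moment, higher_moment; rewrite nu_pow_binomial_S
  by (easy || apply pos_INR); cbn [rsum Nat.sub].
rewrite binom_n_n, binom_2_1, !pow_add; cbn [pow]; field; lra.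
Qed.

Lemma shifted_moment_3 k : eventually (fun b => shifted_moment k 3 b
  = 3 * D ^ 2 * first_moment k b
    + (3 * D * higher_moment k 2 b + higher_moment k 3 b) / INR b).
Proof.
generalize eventually_base_pos; apply filter_imp; intros b (Hb & Hd & Hp).
unfold shifted_moment, first_moment, higher_moment; rewrite nu_pow_binomial_S
  by (easy || apply pos_INR); cbn [rsum Nat.sub].
rewrite binom_n_n, binom_3_1, binom_3_2, !pow_add; cbn [pow]; field; lra.
Qed.

Lemma shifted_moment_4 k : eventually (fun b => shifted_moment k 4 b
  = 4 * D ^ 3 * first_moment k b
    + (6 * D ^ 2 * higher_moment k 2 b + 4 * D * higher_moment k 3 b
    + higher_moment k 4 b) / INR b).
Proof.
generalize eventually_base_pos; apply filter_imp; intros b (Hb & Hd & Hp).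
unfold shifted_moment, first_moment, higher_moment; rewrite nu_pow_binomial_S
  by (easy || apply pos_INR); cbn [rsum Nat.sub].
rewrite binom_n_n, binom_4_1, binom_4_2, binom_4_3, !pow_add; cbn [pow]; field; lra.
Qed.

Lemma shifted_moment_5 k : eventually (fun b => shifted_moment k 5 b
  = 5 * D ^ 4 * first_moment k b + (Binomial.C 5 2 * D ^ 3 * higher_moment k 2 b
      + Binomial.C 5 3 * D ^ 2 * higher_moment k 3 b
        + Binomial.C 5 4 * D * higher_moment k 4 b
      + higher_moment k 5 b) / INR b).
Proof.
generalize eventually_base_pos; apply filter_imp; intros b (Hb & Hd & Hp).
unfold shifted_moment, first_moment, higher_moment; rewrite nu_pow_binomial_S
  by (easy || apply pos_INR); cbn [rsum Nat.sub].
rewrite binom_n_n, binom_5_1, !pow_add; cbn [pow]; field; lra.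
Qed.

(** [head_moment], multiplied by [b ^ (2 k - 1)]. *)
Definition norm_head_moment (k m b : nat) : R :=
  INR b ^ (2 * k) * head_moment d k m b / INR b.

(** The recurrence [nu_pow_rec], multiplied by [b ^ (2 k - 1)] in degree [m = 1] and
    by [b ^ (2 k + 1 - m)] in the degrees [m = 2, 3, 4]. *)
Lemma normalized_rec_1 k :
  eventually (fun b => den 0 b * first_moment k b = norm_head_moment k 1 b).
Proof.
generalize eventually_base_pos; apply filter_imp; intros b (Hb & Hd & Hp).
pose proof (nu_pow_rec d k 0 b Hb Hd) as H; cbn [rsum] in H; rewrite Rplus_0_l in H.
unfold den, first_moment, norm_head_moment; rewrite <- H, pow_add; cbn [pow]; field;
  lra.
Qed.

Lemma normalized_rec_2 k : eventually (fun b => den 1 b * higher_moment k 2 b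
  = (1 - / INR b - 2 * D * (/ INR b) ^ 2) * first_moment k b + norm_head_moment k 2 b).
Proof.
generalize eventually_base_pos; apply filter_imp; intros b (Hb & Hd & Hp).
pose proof (nu_pow_rec d k 1 b Hb Hd) as H; cbn [rsum Nat.sub] in H.
rewrite sigma_1, binom_2_1, Rplus_0_l in H.
transitivity (INR b ^ (2 * k + 2) * / INR b ^ 3 *
  ((INR b ^ 3 - INR b + 1) * nu_pow b d k 0 2)).
- unfold den, higher_moment; cbn [pow]; field; lra.
- rewrite H; unfold den, first_moment, norm_head_moment; rewrite !pow_add; cbn [pow];
  field; lra.
Qed.

Lemma normalized_rec_3 k : eventually (fun b => den 2 b * higher_moment k 3 b
  = (1 - 3 / 2 * / INR b + (/ INR b) ^ 2 / 2
    - 3 * D ^ 2 * (/ INR b) ^ 3) * first_moment k b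
    + (3 / 2 * ((1 - / INR b) / INR b) - 3 * D * (/ INR b) ^ 3) * higher_moment k 2 b
      / INR b
    + norm_head_moment k 3 b / INR b).
Proof.
generalize eventually_base_pos; apply filter_imp; intros b (Hb & Hd & Hp).
pose proof (nu_pow_rec d k 2 b Hb Hd) as H; cbn [rsum Nat.sub] in H.
rewrite sigma_1, sigma_2, binom_3_1, binom_3_2, Rplus_0_l in H.
transitivity (INR b ^ (2 * k + 2) * / INR b ^ 4 *
  ((INR b ^ 4 - INR b + 1) * nu_pow b d k 0 3)).
- unfold den, higher_moment; cbn [pow]; field; lra.
- rewrite H; unfold den, first_moment, higher_moment, norm_head_moment;
  rewrite !pow_add; cbn [pow]; field; lra.
Qed.

Lemma normalized_rec_4 k : eventually (fun b => den 3 b * higher_moment k 4 b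
  = ((1 - / INR b) ^ 2 - 4 * D ^ 3 * (/ INR b) ^ 4) * first_moment k b
    + ((2 - 3 / INR b + (/ INR b) ^ 2
      - 6 * D ^ 2 * (/ INR b) ^ 3) * (higher_moment k 2 b / INR b)
       + (2 * (1 - / INR b) * (/ INR b) ^ 2 - 4 * D * (/ INR b) ^ 4) * higher_moment k
        3 b
       + norm_head_moment k 4 b / INR b) / INR b).
Proof.
generalize eventually_base_pos; apply filter_imp; intros b (Hb & Hd & Hp).
pose proof (nu_pow_rec d k 3 b Hb Hd) as H; cbn [rsum Nat.sub] in H.
rewrite sigma_1, sigma_2, sigma_3, binom_4_1, binom_4_2, binom_4_3, Rplus_0_l in H.
transitivity (INR b ^ (2 * k + 2) * / INR b ^ 5 *
  ((INR b ^ 5 - INR b + 1) * nu_pow b d k 0 4)).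
- unfold den, higher_moment; cbn [pow]; field; lra.
- rewrite H; unfold den, first_moment, higher_moment, norm_head_moment;
  rewrite !pow_add; cbn [pow]; field; lra.
Qed.

Lemma norm_head_moment_0 m : eventually (fun b => norm_head_moment 0 m b =
  - ((D + 1) ^ S m / INR (S m) - D ^ S m / INR (S m))).
Proof.
generalize eventually_pos; apply filter_imp; intros b Hp.
unfold norm_head_moment; cbn [head_moment Nat.mul]; rewrite pow_O; field.
split; [apply not_0_INR; lia | lra].
Qed.

Lemma norm_head_moment_S k m :
  eventually (fun b => norm_head_moment (S k) m b = shifted_moment k m b).
Proof.
generalize eventually_pos; apply filter_imp; intros b Hp.
unfold norm_head_moment, shifted_moment; cbn [head_moment].
replace (2 * S k)%nat with (S (2 * k + 1)) by lia; cbn [pow]; field; lra.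
Qed.

End Coefficients.

(** * Coefficients of the first moments *)

Section MomentCoefficients.
Context (d : nat).
Notation D := (INR d).
Notation e := (INR d + 1 / 2).

Lemma expansion_horner_eq l f : (forall b, f b = horner l (/ INR b)) -> expansion l f.
Proof.
intros H; apply expansion_ext with (2 := expansion_horner l), filter_forall; intros b;
  now rewrite H.
Qed.

Lemma expansion_norm_head_moment_0 m n :
  expansion (- ((D + 1) ^ S m / INR (S m) - D ^ S m / INR (S m)) :: repeat 0 n)
  (norm_head_moment d 0 m).
Proof.
apply expansion_ext with (2 := expansion_const _ n).
generalize (norm_head_moment_0 d m); apply filter_imp; intros b H; now rewrite H.
Qed.

Lemma expansion_norm_head_moment_S k m l : expansion l (shifted_moment d k m) ->
  expansion l (norm_head_moment d (S k) m).
Proof.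
apply expansion_ext; generalize (norm_head_moment_S d k m); apply filter_imp;
  intros b H; now rewrite H.
Qed.

Lemma expansion_shifted_moment_1 k l : expansion l (first_moment d k) ->
  expansion l (shifted_moment d k 1).
Proof.
apply expansion_ext; generalize (shifted_moment_1 d k); apply filter_imp; intros b H;
  now rewrite H.
Qed.

Lemma expansion_shifted_moment_2 k l l' : expansion l (first_moment d k) ->
  expansion l' (higher_moment d k 2) ->
  expansion (ladd (map (Rmult (2 * D)) l) (0 :: l')) (shifted_moment d k 2).
Proof.
intros H1 H2; eapply expansion_ext;
  [|apply expansion_add; [apply expansion_scal, H1 | apply expansion_over_b, H2]].
generalize (shifted_moment_2 d k); apply filter_imp; intros b H; now rewrite H.
Qed.

Lemma expansion_shifted_moment_3 k l l' : expansion l (first_moment d k) ->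
  expansion l' (fun b => 3 * D * higher_moment d k 2 b + higher_moment d k 3 b) ->
  expansion (ladd (map (Rmult (3 * D ^ 2)) l) (0 :: l')) (shifted_moment d k 3).
Proof.
intros H1 H2; eapply expansion_ext;
  [|apply expansion_add; [apply expansion_scal, H1 | apply expansion_over_b, H2]].
generalize (shifted_moment_3 d k); apply filter_imp; intros b H; now rewrite H.
Qed.

Lemma expansion_first_moment k l l' : expansion l (norm_head_moment d k 1) ->
  ldiv (length l) l 1 [-1; 1; 0; 0] = l' ->
  expansion l' (first_moment d k).
Proof.
intros H <-; apply expansion_div with (2 := expansion_den0); [lra|].
apply expansion_ext with (2 := H); generalize (normalized_rec_1 d k); apply filter_imp.
intros b E1; now rewrite E1.
Qed.

Lemma expansion_higher_moment_2 k l l' l'' : expansion l (first_moment d k) ->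
  expansion l' (norm_head_moment d k 2) ->
  (let m := ladd (lmul [1; -1; -2 * D] l) l' in ldiv (length m) m 1 [0; -1; 1]) = l'' ->
  expansion l'' (higher_moment d k 2).
Proof.
intros H1 H2 <-; apply expansion_div with (2 := expansion_den1); [lra|].
assert (H3 : expansion [1; -1; -2 * D] (fun b => 1 - / INR b - 2 * D * (/ INR b) ^ 2))
  by (apply expansion_horner_eq; intros; cbn; ring).
apply expansion_ext with (2 := expansion_add _ _ _ _ (expansion_mul _ _ _ _ H3 H1) H2).
generalize (normalized_rec_2 d k); apply filter_imp.
intros b E1; now rewrite E1.
Qed.

Lemma expansion_higher_moment_3 k l l' l'' : expansion l (first_moment d k) ->
  expansion l' (norm_head_moment d k 3) ->
  (let m := ladd (ladd (lmul [1; - (3 / 2)] l) [0; 0]) (0 :: l') in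
   ldiv (length m) m 1 [0; 0; -1; 1]) = l'' ->
  expansion l'' (higher_moment d k 3).
Proof.
intros H1 H2 <-; apply expansion_div with (2 := expansion_den2); [lra|].
assert (H3 : expansion [1; - (3 / 2)] (fun b => 1 - 3 / 2 * / INR b + (/ INR b) ^ 2 / 2
    - 3 * D ^ 2 * (/ INR b) ^ 3)).
{ apply (expansion_firstn 2 [1; - (3 / 2); 1 / 2; - (3 * D ^ 2)]).
  apply expansion_horner_eq; intros; generalize (/ INR b); intros; cbn; field. }
assert (H4 : expansion [0; 0] (fun b => (3 / 2 * ((1 - / INR b) / INR b)
    - 3 * D * (/ INR b) ^ 3) * higher_moment d k 2 b / INR b)).
{ apply expansion_over_b.
  (* The leading coefficient [c] of the moment does not matter here. *)
  destruct (expandable_higher_moment d 1 k 0) as [[|c [|c' l0]] [Hl Hc]];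
    try discriminate Hl.
  apply (expansion_eq (lmul [0] [c])); [list_field|].
  apply expansion_mul with (2 := Hc).
  apply (expansion_firstn 1 [0; 3 / 2; - (3 / 2); - (3 * D)]), expansion_horner_eq.
  intros; unfold Rdiv at 2; generalize (/ INR b); intros; cbn; field. }
apply expansion_ext with (2 :=
  expansion_add _ _ _ _ (expansion_add _ _ _ _ (expansion_mul _ _ _ _ H3 H1) H4)
  (expansion_over_b _ _ H2)).
generalize (normalized_rec_3 d k); apply filter_imp.
intros b E1; now rewrite E1.
Qed.

Lemma expansion_higher_moment_4 k c : expansion [c] (first_moment d k) ->
  bdd (norm_head_moment d k 4) -> expansion [c] (higher_moment d k 4).
Proof.
intros H1 H2; apply (expansion_eq (ldiv 1 [1 * c] 1 [0; 0; 0; -1; 1])); [list_field|].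
apply expansion_div with (2 := expansion_den3); [lra|].
assert (H3 : expansion [1] (fun b => (1 - / INR b) ^ 2 - 4 * D ^ 3 * (/ INR b) ^ 4)).
{ apply (expansion_firstn 1 [1; -2; 1; 0; - (4 * D ^ 3)]), expansion_horner_eq; intros;
  cbn; ring. }
assert (H4 : bdd (fun b =>
   (2 - 3 / INR b + (/ INR b) ^ 2
     - 6 * D ^ 2 * (/ INR b) ^ 3) * (higher_moment d k 2 b / INR b)
   + (2 * (1 - / INR b) * (/ INR b) ^ 2 - 4 * D * (/ INR b) ^ 4) * higher_moment d k 3 b
   + norm_head_moment d k 4 b / INR b)).
{ assert (B2 : bdd (higher_moment d k 2)) by apply (expandable_bdd 0),
  expandable_higher_moment.
  assert (B3 : bdd (higher_moment d k 3)) by apply (expandable_bdd 0),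
    expandable_higher_moment.
  apply bdd_plus; [apply bdd_plus|]; apply bdd_mult; auto using bdd_inv, bdd_mult.
  - apply (expansion_bdd [2; -3; 1; - (6 * D ^ 2)]), expansion_horner_eq; intros; cbn;
    unfold Rdiv; ring.
  - now apply bdd_mult; [|apply bdd_inv].
  - apply (expansion_bdd [0; 0; 2; -2; - (4 * D)]), expansion_horner_eq; intros; cbn;
    ring. }
apply (expansion_eq (ladd (lmul [1] [c]) [0])); [list_field|].
apply expansion_ext with (2 :=
  expansion_add _ _ _ _ (expansion_mul _ _ _ _ H3 H1) (expansion_over_b [] _ H4)).
generalize (normalized_rec_4 d k); apply filter_imp.
intros b E1; now rewrite E1.
Qed.

Lemma expansion_first_moment_0 : expansion [- e; - e; 0; e; e] (first_moment d 0).
Proof.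
apply expansion_first_moment with (1 := expansion_norm_head_moment_0 1 4).
cbn [repeat INR]; list_field.
Qed.

Lemma expansion_first_moment_1 :
  expansion [- e; - (2 * e); - e; 2 * e] (first_moment d 1).
Proof.
eapply expansion_first_moment;
  [apply expansion_norm_head_moment_S, expansion_shifted_moment_1,
  (expansion_firstn 4), expansion_first_moment_0|].
cbn [firstn]; list_field.
Qed.

Lemma expansion_first_moment_2 : expansion [- e; - (3 * e)] (first_moment d 2).
Proof.
eapply expansion_first_moment;
  [apply expansion_norm_head_moment_S, expansion_shifted_moment_1,
  (expansion_firstn 2), expansion_first_moment_1|].
cbn [firstn]; list_field.
Qed.

Lemma expansion_higher_moment_0_2 :
  expansion [- e - (D ^ 2 + D + 1 / 3); 0; 2 * D * e
    - (D ^ 2 + D + 1 / 3)] (higher_moment d 0 2).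
Proof.
eapply expansion_higher_moment_2;
  [apply expansion_first_moment_0 | apply (expansion_norm_head_moment_0 2 4)|].
cbn [repeat INR]; cbv zeta; list_field.
Qed.

Lemma expansion_higher_moment_0_3 :
  expansion [- e; e / 2 - ((D + 1) ^ 4 - D ^ 4) / 4] (higher_moment d 0 3).
Proof.
eapply expansion_higher_moment_3;
  [apply expansion_first_moment_0 | apply (expansion_norm_head_moment_0 3 4)|].
cbn [repeat INR]; cbv zeta; list_field.
Qed.

Lemma expansion_higher_moment_0_4 : expansion [- e] (higher_moment d 0 4).
Proof.
apply expansion_higher_moment_4;
  [apply (expansion_firstn 1 _ _ expansion_first_moment_0)|].
apply expansion_bdd with (1 := expansion_norm_head_moment_0 4 0).
Qed.

Lemma expansion_shifted_moment_0_2 :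
  expansion [- (2 * D * e); - (2 * D * e) - e - (D ^ 2 + D + 1 / 3);
   0; 4 * D * e - (D ^ 2 + D + 1 / 3)] (shifted_moment d 0 2).
Proof.
eapply expansion_eq;
  [|apply expansion_shifted_moment_2;
  [apply expansion_first_moment_0 | apply expansion_higher_moment_0_2]]; list_field.
Qed.

Lemma expansion_shifted_moment_0_3 : expansion [- (3 * D ^ 2 * e);
   - (3 * D ^ 2 * e) - 3 * D * (e + (D ^ 2 + D + 1 / 3)) - e;
   e / 2 - ((D + 1) ^ 4 - D ^ 4) / 4] (shifted_moment d 0 3).
Proof.
eapply expansion_eq;
  [|apply expansion_shifted_moment_3;
  [apply expansion_first_moment_0 | apply expansion_add;
  [apply expansion_scal, expansion_higher_moment_0_2 |
    apply expansion_higher_moment_0_3]]]; list_field.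
Qed.

Lemma expansion_shifted_moment_0_4 : expansion [- (4 * D ^ 3 * e);
   - (4 * D ^ 3 * e) - 6 * D ^ 2 * (e + (D ^ 2 + D + 1 / 3)) - 4 * D * e
     - e] (shifted_moment d 0 4).
Proof.
eapply expansion_eq; [|eapply expansion_ext; [|apply expansion_add;
  [apply (expansion_scal (4 * D ^ 3)), expansion_first_moment_0 |
   apply expansion_over_b, expansion_add;
     [apply expansion_add;
     [apply (expansion_scal (6 * D ^ 2)), expansion_higher_moment_0_2
    | apply (expansion_scal (4 * D)), expansion_higher_moment_0_3] |
      apply expansion_higher_moment_0_4]]]].
- list_field.
- generalize (shifted_moment_4 d 0); apply filter_imp; intros b H; now rewrite H.
Qed.

Lemma expansion_shifted_moment_0_5 :
  expansion [- (5 * D ^ 4 * e)] (shifted_moment d 0 5).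
Proof.
assert (B : bdd (fun b => Binomial.C 5 2 * D ^ 3 * higher_moment d 0 2 b
      + Binomial.C 5 3 * D ^ 2 * higher_moment d 0 3 b
        + Binomial.C 5 4 * D * higher_moment d 0 4 b
      + higher_moment d 0 5 b)).
{ apply (expandable_bdd 0); repeat apply expandable_plus; try apply expandable_scal;
  apply expandable_higher_moment. }
eapply expansion_eq; [|eapply expansion_ext; [|apply expansion_add;
  [apply (expansion_scal (5 * D ^ 4)), expansion_first_moment_0 |
    exact (expansion_over_b [] _ B)]]].
- list_field.
- generalize (shifted_moment_5 d 0); apply filter_imp; intros b H; now rewrite H.
Qed.

Lemma expansion_higher_moment_1_2 :
  expansion [- e - 2 * D * e; - (2 * e) - 2 * D * e
  - (D ^ 2 + D + 1 / 3)] (higher_moment d 1 2).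
Proof.
eapply expansion_higher_moment_2; [apply (expansion_firstn 2), expansion_first_moment_1
  | apply expansion_norm_head_moment_S, (expansion_firstn 2),
    expansion_shifted_moment_0_2|].
cbn [firstn]; cbv zeta; list_field.
Qed.

Lemma expansion_higher_moment_1_3 : expansion [- e] (higher_moment d 1 3).
Proof.
apply (expansion_firstn 1 [- e; - (2 * e) + 3 / 2 * e - 3 * D ^ 2 * e]).
eapply expansion_higher_moment_3;
  [apply expansion_first_moment_1 | apply expansion_norm_head_moment_S,
  expansion_shifted_moment_0_3|].
cbv zeta; list_field.
Qed.

Lemma expansion_shifted_moment_1_2 :
  expansion [- (2 * D * e); - (4 * D * e) - e - 2 * D * e] (shifted_moment d 1 2).
Proof.
eapply expansion_eq;
  [|apply expansion_shifted_moment_2;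
  [apply (expansion_firstn 2), expansion_first_moment_1
  | apply (expansion_firstn 1), expansion_higher_moment_1_2]]; cbn [firstn]; list_field.
Qed.

Lemma expansion_shifted_moment_1_3 :
  expansion [- (3 * D ^ 2 * e)] (shifted_moment d 1 3).
Proof.
eapply expansion_eq;
  [|apply expansion_shifted_moment_3;
  [apply (expansion_firstn 1), expansion_first_moment_1
  | apply (expansion_nil 0); apply expandable_plus; [apply expandable_scal|];
    apply expandable_higher_moment]];
cbn [firstn]; list_field.
Qed.

End MomentCoefficients.

(** * Coefficients of the power sums *)

(** The reciprocal of [poch p (c b)], multiplied by [b ^ p]. *)
Definition poch_inv (p : nat) (c : R) (b : nat) : R := INR b ^ p * / poch p (c * INR b).

Section PochhammerCoefficients.
Context (c : R) (Hc : 0 < c).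

Lemma poch_inv_S p : eventually (fun b =>
  poch_inv p c b * (INR b * / (c * INR b + INR p)) = poch_inv (S p) c b).
Proof.
generalize eventually_pos; apply filter_imp; intros b Hb; unfold poch_inv;
  cbn [poch pow].
assert (0 < c * INR b) by nra; pose proof (pos_INR p).
pose proof (poch_pos p (c * INR b) ltac:(lra)); field; lra.
Qed.

Lemma expansion_poch_factor p :
  expansion [/ c; - (INR p / c ^ 2); INR p ^ 2 / c ^ 3; - (INR p ^ 3 / c ^ 4)]
    (fun b => INR b * / (c * INR b + INR p)).
Proof.
apply (expansion_eq (ldiv 4 [1; 0; 0; 0] c [INR p; 0; 0])); [list_field|].
apply expansion_div with (fun b => c + INR p * / INR b); [lra| |].
- apply expansion_horner_eq; intros; cbn; ring.
- apply expansion_ext with (2 := expansion_const 1 3).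
  generalize eventually_pos; apply filter_imp; intros b Hb.
  assert (0 < c * INR b) by nra; pose proof (pos_INR p); field; lra.
Qed.

Lemma expansion_poch_inv_S p l : expansion l (poch_inv p c) ->
  expansion (lmul l [/ c; - (INR p / c ^ 2); INR p ^ 2 / c ^ 3; - (INR p ^ 3 / c ^ 4)])
    (poch_inv (S p) c).
Proof. intros H; exact
  (expansion_ext _ _ _ (poch_inv_S p)
  (expansion_mul _ _ _ _ H (expansion_poch_factor p))). Qed.

Lemma expansion_poch_inv_1 : expansion [/ c; 0; 0; 0] (poch_inv 1 c).
Proof.
eapply expansion_eq;
  [|apply expansion_poch_inv_S, expansion_ext with (2 := expansion_const 1 3)].
- cbn [repeat INR]; list_field.
- apply filter_forall; intros b; unfold poch_inv; cbn; field.
Qed.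

Lemma expansion_poch_inv_2 : expansion [/ c ^ 2; - / c ^ 3; / c ^ 4] (poch_inv 2 c).
Proof.
eapply expansion_eq;
  [|apply expansion_poch_inv_S, (expansion_firstn 3), expansion_poch_inv_1].
cbn [firstn INR]; list_field.
Qed.

Lemma expansion_poch_inv_3 : expansion [/ c ^ 3; - (3 / c ^ 4)] (poch_inv 3 c).
Proof.
eapply expansion_eq;
  [|apply expansion_poch_inv_S, (expansion_firstn 2), expansion_poch_inv_2].
cbn [firstn INR]; list_field.
Qed.

Lemma expansion_poch_inv_4 : expansion [/ c ^ 4] (poch_inv 4 c).
Proof.
eapply expansion_eq;
  [|apply expansion_poch_inv_S, (expansion_firstn 1), expansion_poch_inv_3].
cbn [firstn INR]; list_field.
Qed.

End PochhammerCoefficients.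

Section FirstCoefficients.
Context (d : nat) (Hd0 : (0 < d)%nat).
Notation D := (INR d).
Notation e := (INR d + 1 / 2).

(** [inv_sum], multiplied by a power of [b] that makes it bounded. *)
Definition norm_inv_sum (s p b : nat) : R := INR b ^ (s + p - 1) * inv_sum d s p b.

Lemma D_pos : 0 < D.
Proof. now apply lt_0_INR. Qed.

Lemma expandable_norm_inv_sum N s p : (2 <= s + p)%nat ->
  expandable N (norm_inv_sum s p).
Proof. now apply expandable_inv_sum. Qed.

Lemma expansion_norm_inv_sum_0 p l l' : expansion l (poch_inv (S p) D) ->
  expansion l' (poch_inv (S p) (D + 1)) ->
  expansion (map (Rmult (/ INR (S p))) (ladd l (map (Rmult (-1)) l')))
    (norm_inv_sum 0 (S (S p))).
Proof.
intros H1 H2; eapply expansion_ext;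
  [|apply expansion_scal, expansion_add; [exact H1 | apply expansion_scal, H2]].
generalize (eventually_ge 1); apply filter_imp; intros b Hb; unfold norm_inv_sum.
rewrite (inv_sum_tele d Hd0) by lia; unfold poch_inv; cbn [Nat.add Nat.sub]; ring.
Qed.

Lemma expansion_norm_inv_sum_S s p l l' : expansion l (norm_inv_sum s (S p)) ->
  expansion l' (norm_inv_sum (S s) (S p)) ->
  expansion (ladd l (map (Rmult (INR p)) (0 :: l'))) (norm_inv_sum (S s) p).
Proof.
intros H1 H2; eapply expansion_ext;
  [|apply expansion_add; [exact H1 | apply expansion_scal, expansion_over_b, H2]].
generalize (eventually_ge 1); apply filter_imp; intros b Hb; unfold norm_inv_sum.
assert (0 < INR b) by (apply lt_0_INR; lia).
rewrite (inv_sum_step d Hd0 s p b) by lia.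
replace (S s + S p - 1)%nat with (S (s + S p - 1)) by lia.
replace (S s + p - 1)%nat with (s + S p - 1)%nat by lia.
cbn [pow]; field; lra.
Qed.

Lemma expansion_norm_inv_sum_0_2 :
  expansion [/ D - / (D + 1); 0; 0; 0] (norm_inv_sum 0 2).
Proof.
pose proof D_pos.
eapply expansion_eq; [|apply expansion_norm_inv_sum_0; apply expansion_poch_inv_1;
  lra]; cbn [INR]; list_field.
Qed.

Lemma expansion_norm_inv_sum_0_3 : expansion [(/ D ^ 2 - / (D + 1) ^ 2) / 2;
  - ((/ D ^ 3 - / (D + 1) ^ 3) / 2); (/ D ^ 4 - / (D + 1) ^ 4) / 2] (norm_inv_sum 0 3).
Proof.
pose proof D_pos.
eapply expansion_eq; [|apply expansion_norm_inv_sum_0; apply expansion_poch_inv_2;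
  lra]; cbn [INR]; list_field.
Qed.

Lemma expansion_norm_inv_sum_0_4 : expansion [(/ D ^ 3 - / (D + 1) ^ 3) / 3;
  - (/ D ^ 4 - / (D + 1) ^ 4)] (norm_inv_sum 0 4).
Proof.
pose proof D_pos.
eapply expansion_eq; [|apply expansion_norm_inv_sum_0; apply expansion_poch_inv_3;
  lra]; cbn [INR]; list_field.
Qed.

Lemma expansion_norm_inv_sum_0_5 :
  expansion [(/ D ^ 4 - / (D + 1) ^ 4) / 4] (norm_inv_sum 0 5).
Proof.
pose proof D_pos.
eapply expansion_eq; [|apply expansion_norm_inv_sum_0; apply expansion_poch_inv_4;
  lra]; cbn [INR]; list_field.
Qed.

Lemma expansion_norm_inv_sum_nil s p : (2 <= s + p)%nat ->
  expansion [] (norm_inv_sum s p).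
Proof. intros; now apply (expansion_nil 0), expandable_norm_inv_sum. Qed.

Lemma expansion_norm_inv_sum_1_3 :
  expansion [(/ D ^ 3 - / (D + 1) ^ 3) / 3; - (/ D ^ 4 - / (D + 1) ^ 4) / 4]
  (norm_inv_sum 1 3).
Proof.
pose proof D_pos.
eapply expansion_eq;
  [|apply expansion_norm_inv_sum_S;
  [apply expansion_norm_inv_sum_0_4 | apply expansion_norm_inv_sum_S;
  [apply expansion_norm_inv_sum_0_5 | apply expansion_norm_inv_sum_nil; lia]]];
    cbn [INR]; list_field.
Qed.

Lemma expansion_norm_inv_sum_1_2 : expansion [(/ D ^ 2 - / (D + 1) ^ 2) / 2;
  (/ D ^ 3 - / (D + 1) ^ 3) / 6; 0] (norm_inv_sum 1 2).
Proof.
pose proof D_pos.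
eapply expansion_eq;
  [|apply expansion_norm_inv_sum_S;
  [apply expansion_norm_inv_sum_0_3 | apply expansion_norm_inv_sum_1_3]];
cbn [INR]; list_field.
Qed.

Lemma expansion_norm_inv_sum_2_0 :
  expansion [/ D - / (D + 1); (/ D ^ 2 - / (D + 1) ^ 2) / 2;
  (/ D ^ 3 - / (D + 1) ^ 3) / 6; 0] (norm_inv_sum 2 0).
Proof.
pose proof D_pos.
assert (H1 : expansion [/ D - / (D + 1); (/ D ^ 2 - / (D + 1) ^ 2) / 2;
  (/ D ^ 3 - / (D + 1) ^ 3) / 6; 0] (norm_inv_sum 1 1)).
{ eapply expansion_eq;
  [|apply expansion_norm_inv_sum_S;
  [apply expansion_norm_inv_sum_0_2 | apply expansion_norm_inv_sum_1_2]];
  cbn [INR]; list_field. }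
(* The factor [p = 0] annihilates the coefficients [u], [v], [w]. *)
destruct (expandable_norm_inv_sum 3 2 1 ltac:(lia)) as [[|u [|v [|w [|? ?]]]] [Hl H2]];
  try discriminate Hl.
eapply expansion_eq; [|apply expansion_norm_inv_sum_S; [exact H1 | exact H2]];
  cbn [INR]; list_field.
Qed.

Lemma expansion_norm_inv_sum_2_2 :
  expansion [(/ D ^ 3 - / (D + 1) ^ 3) / 3] (norm_inv_sum 2 2).
Proof.
pose proof D_pos.
eapply expansion_eq;
  [|apply expansion_norm_inv_sum_S;
  [apply (expansion_firstn 1), expansion_norm_inv_sum_1_3
  | apply expansion_norm_inv_sum_nil; lia]]; cbn [firstn INR]; list_field.
Qed.

Lemma expansion_norm_inv_sum_3_0 : expansion [(/ D ^ 2 - / (D + 1) ^ 2) / 2;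
  (/ D ^ 3 - / (D + 1) ^ 3) / 2] (norm_inv_sum 3 0).
Proof.
pose proof D_pos.
(* As before, [u] is multiplied by [0]. *)
destruct (expandable_norm_inv_sum 1 3 1 ltac:(lia)) as [[|u [|? ?]] [Hl H2]];
  try discriminate Hl.
eapply expansion_eq; [|apply expansion_norm_inv_sum_S; [apply expansion_norm_inv_sum_S;
  [apply (expansion_firstn 2), expansion_norm_inv_sum_1_2 |
    apply expansion_norm_inv_sum_2_2] | exact H2]];
cbn [firstn INR]; list_field.
Qed.

Lemma expansion_norm_inv_sum_4_0 :
  expansion [(/ D ^ 3 - / (D + 1) ^ 3) / 3] (norm_inv_sum 4 0).
Proof.
pose proof D_pos.
eapply expansion_eq;
  [|apply expansion_norm_inv_sum_S;
  [apply expansion_norm_inv_sum_S; [apply expansion_norm_inv_sum_2_2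
   | apply expansion_norm_inv_sum_nil; lia] | apply expansion_norm_inv_sum_nil; lia]];
     cbn [INR]; list_field.
Qed.

(** The differences of moments about [- d] in [main_part], multiplied by a power
    of [b] that makes them bounded. *)
Definition norm_d1 (m b : nat) : R := INR b ^ 3 * nu_pow_d1 d D m b.
Definition norm_d2 (m b : nat) : R := INR b * nu_pow_d2 d D m b.

Lemma expansion_norm_d1 m l l' : expansion l (shifted_moment d 1 m) ->
  expansion l' (shifted_moment d 2 m) ->
  expansion (ladd l (map (Rmult (-1)) (0 :: 0 :: l'))) (norm_d1 m).
Proof.
intros H1 H2; eapply expansion_ext;
  [|apply expansion_add;
    [exact H1 | apply expansion_scal, expansion_over_b, expansion_over_b, H2]].
generalize eventually_pos; apply filter_imp; intros b Hb.
unfold norm_d1, nu_pow_d1, shifted_moment; cbn [Nat.mul Nat.add pow]; field; lra.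
Qed.

Lemma expansion_norm_d2 m l0 l1 l2 : expansion l0 (shifted_moment d 0 m) ->
  expansion l1 (shifted_moment d 1 m) -> expansion l2 (shifted_moment d 2 m) ->
  expansion (ladd (ladd l0 (map (Rmult (-2)) (0 :: 0 :: l1))) (0 :: 0 :: 0 :: 0 :: l2))
    (norm_d2 m).
Proof.
intros H0 H1 H2; eapply expansion_ext;
  [|apply expansion_add;
    [apply expansion_add;
    [exact H0 | apply expansion_scal, expansion_over_b, expansion_over_b, H1]
    | do 4 apply expansion_over_b; exact H2]].
generalize eventually_pos; apply filter_imp; intros b Hb.
unfold norm_d2, nu_pow_d2, shifted_moment; cbn [Nat.mul Nat.add pow]; field; lra.
Qed.

Lemma expansion_shifted_moment_nil k m : expansion [] (shifted_moment d k (S m)).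
Proof. apply (expansion_nil 0), expandable_shifted_moment. Qed.

(** The same about [0] and for degrees at least [2]. *)
Definition norm0_d1 (m b : nat) : R := INR b ^ 4 * nu_pow_d1 d 0 m b.

Lemma expansion_PK0_1 l l' : expansion l (first_moment d 1) ->
  expansion l' (first_moment d 2) ->
  expansion (ladd l (map (Rmult (-1)) (0 :: 0 :: l'))) (fun b =>
    INR b ^ 3 * nu_pow_d1 d 0 1 b).
Proof.
intros H1 H2; eapply expansion_ext;
  [|apply expansion_add;
    [exact H1 | apply expansion_scal, expansion_over_b, expansion_over_b, H2]].
generalize eventually_pos; apply filter_imp; intros b Hb.
unfold nu_pow_d1, first_moment; cbn [Nat.mul Nat.add pow]; field; lra.
Qed.

Lemma expansion_norm0_d1 m l : expansion l (higher_moment d 1 (S (S m))) ->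
  expansion (ladd l [0; 0]) (norm0_d1 (S (S m))).
Proof.
intros H1; assert (H2 : expansion [] (higher_moment d 2 (S (S m))))
  by apply (expansion_nil 0), expandable_higher_moment.
apply expansion_ext with (fun b => higher_moment d 1 (S (S m)) b
  + -1 * (higher_moment d 2 (S (S m)) b / INR b / INR b)).
- generalize eventually_pos; apply filter_imp; intros b Hb.
  unfold norm0_d1, nu_pow_d1, higher_moment; cbn [Nat.mul Nat.add pow]; field; lra.
- apply expansion_add with (1 := H1), (expansion_eq (map (Rmult (-1)) [0; 0]));
  [list_field|].
  now apply expansion_scal, expansion_over_b, expansion_over_b.
Qed.

End FirstCoefficients.

(** * The first coefficients of the sum *)

Lemma expansion_shift n l f : expansion l f ->
  expansion (repeat 0 n ++ l) (fun b => (/ INR b) ^ n * f b).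
Proof.
intros H; induction n as [|n IH].
- apply expansion_ext with (2 := H), filter_forall; intros; cbn; ring.
- apply expansion_ext with (2 := expansion_over_b _ _ IH), filter_forall.
  intros; cbn [pow]; unfold Rdiv; ring.
Qed.

Lemma expansion_shift_zero n f : (5 <= n)%nat -> bdd f ->
  expansion [0; 0; 0; 0; 0] (fun b => (/ INR b) ^ n * f b).
Proof.
intros Hn H; pose proof (expansion_firstn 5 _ _ (expansion_shift n [] f H)) as H1.
destruct n as [|[|[|[|[|n]]]]]; try lia; exact H1.
Qed.

Section TotalCoefficients.
Context (d : nat) (Hd0 : (0 < d)%nat).
Notation D := (INR d).
Notation e := (INR d + 1 / 2).

(** The three contributions to the summand of index [j] of [main_part],
    multiplied by [b ^ 3]. *)
Definition part1 (j b : nat) : R :=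
  (/ INR b) ^ S (S j) * (zeta (S (S j)) * norm_d1 d (S j) b).
Definition part2 (j b : nat) : R :=
  INR b ^ 3 * inv_sum d (S (S j)) 0 b * nu_pow_d1 d 0 (S j) b.
Definition part3 (j b : nat) : R :=
  (/ INR b) ^ j * ((/ D) ^ S (S j) * norm_d2 d (S j) b).

(** The coefficients of the summand of index [j], from those of its parts. *)
Definition coef_sum (j : nat) (l1 l2 l3 : list R) : list R :=
  map (Rmult ((-1) ^ S j)) (ladd (ladd l1 l2) l3).

Lemma expansion_summand j l1 l2 l3 : expansion l1 (part1 j) ->
  expansion l2 (part2 j) -> expansion l3 (part3 j) ->
  expansion (coef_sum j l1 l2 l3) (fun b => INR b ^ 3 * ((-1) ^ S j *
    ((/ INR b) ^ S (S j) * zeta (S (S j)) * nu_pow_d1 d D (S j) b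
     + inv_sum d (S (S j)) 0 b * nu_pow_d1 d 0 (S j) b
     + / (D * INR b) ^ S (S j) * nu_pow_d2 d D (S j) b))).
Proof.
intros H1 H2 H3; eapply expansion_ext;
  [|apply expansion_scal, expansion_add;
    [apply expansion_add; [exact H1 | exact H2] | exact H3]].
pose proof (D_pos d Hd0).
generalize eventually_pos; apply filter_imp; intros b Hb.
assert (INR b ^ j <> 0) by (apply pow_nonzero; lra).
assert (D ^ j <> 0) by (apply pow_nonzero; lra).
unfold part1, part2, part3, norm_d1, norm_d2; rewrite Rpow_mult_distr, !pow_inv;
  cbn [pow].
field; repeat split; lra.
Qed.

Lemma bdd_norm_d1 j : bdd (norm_d1 d (S j)).
Proof.
apply (expansion_bdd (ladd [] (map (Rmult (-1)) [0; 0]))), expansion_norm_d1;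
  apply expansion_shifted_moment_nil.
Qed.

Lemma bdd_norm_d2 j : bdd (norm_d2 d (S j)).
Proof.
apply (expansion_bdd (ladd (ladd [] (map (Rmult (-2)) [0; 0])) [0; 0; 0; 0])),
  expansion_norm_d2;
apply expansion_shifted_moment_nil.
Qed.

Lemma part1_zero j : expansion [0; 0; 0; 0; 0] (part1 (S (S (S j)))).
Proof.
apply expansion_shift_zero; [lia|]; apply bdd_mult;
  [apply bdd_const | apply bdd_norm_d1].
Qed.

Lemma part2_S j l l' : expansion l (norm_inv_sum d (S (S (S j))) 0) ->
  expansion l' (norm0_d1 d (S (S j))) ->
  expansion (repeat 0 (S (S (S j))) ++ lmul l l') (part2 (S j)).
Proof.
intros H1 H2; eapply expansion_ext;
  [|apply expansion_shift, expansion_mul; [exact H1 | exact H2]].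
generalize eventually_pos; apply filter_imp; intros b Hb.
assert (INR b ^ j <> 0) by (apply pow_nonzero; lra).
unfold part2, norm_inv_sum, norm0_d1; rewrite pow_inv.
replace (S (S (S j)) + 0 - 1)%nat with (S (S j)) by lia; cbn [pow]; field; lra.
Qed.

Lemma part2_zero j : expansion [0; 0; 0; 0; 0] (part2 (S (S (S j)))).
Proof.
apply (expansion_firstn 5 _ _ (part2_S (S (S j)) [] []
  ltac:(apply expansion_norm_inv_sum_nil; [easy | lia])
  (expansion_firstn 0 _ _
    (expansion_norm0_d1 d (S (S j)) []
    (expansion_nil 0 _ (expandable_higher_moment d 0 1 _)))))).
Qed.

Lemma part3_zero j : expansion [0; 0; 0; 0; 0] (part3 (5 + j)).
Proof.
apply expansion_shift_zero; [lia|]; apply bdd_mult;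
  [apply bdd_const | apply bdd_norm_d2].
Qed.

Lemma expansion_part1 j l : expansion l (norm_d1 d (S j)) ->
  expansion (repeat 0 (S (S j)) ++ map (Rmult (zeta (S (S j)))) l) (part1 j).
Proof. intros; now apply expansion_shift, expansion_scal. Qed.

Lemma expansion_part3 j l : expansion l (norm_d2 d (S j)) ->
  expansion (repeat 0 j ++ map (Rmult ((/ D) ^ S (S j))) l) (part3 j).
Proof. intros; now apply expansion_shift, expansion_scal. Qed.

Lemma expansion_norm_d1_1 : expansion [- e; - (2 * e); 0] (norm_d1 d 1).
Proof.
eapply expansion_eq; [|apply expansion_norm_d1; apply expansion_shifted_moment_1;
  [apply (expansion_firstn 3), expansion_first_moment_1 | apply (expansion_firstn 1),
    expansion_first_moment_2]].
cbn [firstn]; list_field.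
Qed.

Lemma expansion_norm_d1_2 :
  expansion [- (2 * D * e); - (4 * D * e) - e - 2 * D * e] (norm_d1 d 2).
Proof.
eapply expansion_eq;
  [|apply expansion_norm_d1;
  [apply expansion_shifted_moment_1_2 | apply expansion_shifted_moment_nil]];
  list_field.
Qed.

Lemma expansion_norm_d1_3 : expansion [- (3 * D ^ 2 * e)] (norm_d1 d 3).
Proof.
eapply expansion_eq;
  [|apply expansion_norm_d1;
  [apply expansion_shifted_moment_1_3 | apply expansion_shifted_moment_nil]];
  list_field.
Qed.

Lemma expansion_norm_d2_1 : expansion [- e; - e; 2 * e; 5 * e; 2 * e] (norm_d2 d 1).
Proof.
eapply expansion_eq; [|apply expansion_norm_d2; apply expansion_shifted_moment_1;
  [apply expansion_first_moment_0 | apply (expansion_firstn 3),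
    expansion_first_moment_1 | apply (expansion_firstn 1), expansion_first_moment_2]].
cbn [firstn]; list_field.
Qed.

Lemma expansion_norm_d2_2 :
  expansion [- (2 * D * e); - (2 * D * e) - e - (D ^ 2 + D + 1 / 3);
  4 * D * e; 16 * D * e + 2 * e - (D ^ 2 + D + 1 / 3)] (norm_d2 d 2).
Proof.
eapply expansion_eq;
  [|apply expansion_norm_d2;
  [apply expansion_shifted_moment_0_2 | apply expansion_shifted_moment_1_2 |
  apply expansion_shifted_moment_nil]].
list_field.
Qed.

Lemma expansion_norm_d2_3 : expansion [- (3 * D ^ 2 * e);
   - (3 * D ^ 2 * e) - 3 * D * (e + (D ^ 2 + D + 1 / 3)) - e;
   e / 2 - ((D + 1) ^ 4 - D ^ 4) / 4 + 6 * D ^ 2 * e] (norm_d2 d 3).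
Proof.
eapply expansion_eq;
  [|apply expansion_norm_d2;
  [apply expansion_shifted_moment_0_3 | apply expansion_shifted_moment_1_3 |
  apply expansion_shifted_moment_nil]].
list_field.
Qed.

Lemma expansion_norm_d2_4 : expansion [- (4 * D ^ 3 * e);
   - (4 * D ^ 3 * e) - 6 * D ^ 2 * (e + (D ^ 2 + D + 1 / 3)) - 4 * D * e
     - e] (norm_d2 d 4).
Proof.
eapply expansion_eq;
  [|apply expansion_norm_d2;
  [apply expansion_shifted_moment_0_4 | apply expansion_shifted_moment_nil |
  apply expansion_shifted_moment_nil]].
list_field.
Qed.

Lemma expansion_norm_d2_5 : expansion [- (5 * D ^ 4 * e)] (norm_d2 d 5).
Proof.
eapply expansion_eq;
  [|apply expansion_norm_d2;
  [apply expansion_shifted_moment_0_5 | apply expansion_shifted_moment_nil |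
  apply expansion_shifted_moment_nil]].
list_field.
Qed.

Lemma expansion_part2_0 : expansion [0; - e * (/ D - / (D + 1));
    - (2 * e) * (/ D - / (D + 1)) - e * (/ D ^ 2 - / (D + 1) ^ 2) / 2;
    - e * (/ D ^ 2 - / (D + 1) ^ 2) - e * (/ D ^ 3 - / (D + 1) ^ 3) / 6;
    5 * e * (/ D - / (D + 1)) - e * (/ D ^ 3 - / (D + 1) ^ 3) / 3] (part2 0).
Proof.
pose proof (D_pos d Hd0).
eapply expansion_eq; [|eapply expansion_ext; [|apply expansion_over_b, expansion_mul;
  [apply expansion_norm_inv_sum_2_0, Hd0 |
    exact (expansion_PK0_1 d _ _ (expansion_first_moment_1 d)
    (expansion_first_moment_2 d))]]].
- list_field.
- generalize eventually_pos; apply filter_imp; intros b Hb.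
  unfold part2, norm_inv_sum; cbn [Nat.add Nat.sub pow]; field; lra.
Qed.

Lemma expansion_part2_1 : expansion [0; 0; 0;
    (- e - 2 * D * e) * ((/ D ^ 2 - / (D + 1) ^ 2) / 2);
    (- (2 * e) - 2 * D * e - (D ^ 2 + D + 1 / 3)) * ((/ D ^ 2 - / (D + 1) ^ 2) / 2)
    + (- e - 2 * D * e) * ((/ D ^ 3 - / (D + 1) ^ 3) / 2)] (part2 1).
Proof.
pose proof (D_pos d Hd0).
eapply expansion_eq;
  [|apply part2_S; [apply expansion_norm_inv_sum_3_0, Hd0 | apply expansion_norm0_d1,
  expansion_higher_moment_1_2]].
cbn [repeat app]; list_field.
Qed.

Lemma expansion_part2_2 :
  expansion [0; 0; 0; 0; - e * ((/ D ^ 3 - / (D + 1) ^ 3) / 3)] (part2 2).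
Proof.
pose proof (D_pos d Hd0).
eapply expansion_eq;
  [|apply part2_S; [apply expansion_norm_inv_sum_4_0, Hd0 | apply expansion_norm0_d1,
  expansion_higher_moment_1_3]].
cbn [repeat app]; list_field.
Qed.

Lemma expansion_main_part :
  expansion [a1 D; a2 D; a3 D; a4 D; a5 D] (fun b => INR b ^ 3 * main_part d 8 b).
Proof.
pose proof (D_pos d Hd0).
pose proof (expansion_summand 0 _ _ _ (expansion_part1 0 _ expansion_norm_d1_1)
  expansion_part2_0
  (expansion_part3 0 _ expansion_norm_d2_1)) as H0.
pose proof (expansion_summand 1 _ _ _ (expansion_part1 1 _ expansion_norm_d1_2)
  expansion_part2_1
  (expansion_part3 1 _ expansion_norm_d2_2)) as H1.
pose proof (expansion_summand 2 _ _ _ (expansion_part1 2 _ expansion_norm_d1_3)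
  expansion_part2_2
  (expansion_part3 2 _ expansion_norm_d2_3)) as H2.
pose proof (expansion_summand 3 _ _ _ (part1_zero 0) (part2_zero 0)
  (expansion_part3 3 _ expansion_norm_d2_4)) as H3.
pose proof (expansion_summand 4 _ _ _ (part1_zero 1) (part2_zero 1)
  (expansion_part3 4 _ expansion_norm_d2_5)) as H4.
pose proof (expansion_summand 5 _ _ _ (part1_zero 2) (part2_zero 2) (part3_zero 0))
  as H5.
pose proof (expansion_summand 6 _ _ _ (part1_zero 3) (part2_zero 3) (part3_zero 1))
  as H6.
pose proof (expansion_summand 7 _ _ _ (part1_zero 4) (part2_zero 4) (part3_zero 2))
  as H7.
eapply expansion_eq; [|eapply expansion_ext; [|exact
  (expansion_add _ _ _ _
    (expansion_add _ _ _ _ (expansion_add _ _ _ _ (expansion_add _ _ _ _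
    (expansion_add _ _ _ _ (expansion_add _ _ _ _ (expansion_add _ _ _ _ H0 H1) H2) H3)
      H4) H5) H6) H7)]].
- (* The five coefficients agree as rational functions of [d] and zeta values. *)
  unfold coef_sum, a1, a2, a3, a4, a5; cbn [repeat app ladd map].
  repeat (apply (f_equal2 (@cons R)); [field; repeat split; lra|]); reflexivity.
- apply filter_forall; intros b; unfold main_part; cbn [rsum]; ring.
Qed.

Lemma expansion_deviation :
  expansion [a1 D; a2 D; a3 D; a4 D; a5 D] (fun b => INR b ^ 3 * deviation d b).
Proof.
(* Eight moments leave an error that is [O (b ^ -8)]. *)
assert (H : expansion [0; 0; 0; 0; 0]
  (fun b => INR b ^ 3 * (deviation d b - main_part d 8 b))).
{ eapply expansion_ext;
  [|apply (expansion_shift_zero 5); [lia | apply (deviation_main_part d 8 Hd0)]].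
  generalize eventually_pos; apply filter_imp; intros b Hb; cbn [pow]; field; lra. }
eapply expansion_eq;
  [|eapply expansion_ext; [|exact (expansion_add _ _ _ _ H expansion_main_part)]].
- cbn [ladd]; now rewrite !Rplus_0_l.
- apply filter_forall; intros b; ring.
Qed.

End TotalCoefficients.

Theorem proposition13 : forall d : nat, (0 < d)%nat ->
  has_asymptotic_expansion
    (fun b => digit_harmonic_sum b d 2 - INR b * ln (INR b)) /\
  bigO
    (fun b => digit_harmonic_sum b d 2
      - (INR b * ln (INR b)
         + a1 (INR d) / INR b ^ 3
         + a2 (INR d) / INR b ^ 4
         + a3 (INR d) / INR b ^ 5
         + a4 (INR d) / INR b ^ 6
         + a5 (INR d) / INR b ^ 7))
    (fun b => / INR b ^ 8).
Proof.
intros d Hd0; split.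
- apply expandable_expansion; intros N; exact (expandable_deviation N d Hd0).
- destruct (expansion_bound _ _ (expansion_deviation d Hd0)) as [C HC]; exists C.
  generalize (filter_and _ _ HC eventually_pos); apply filter_imp; intros b [H Hb].
  cbn [length horner] in H; unfold deviation in H.
  assert (H3 : 0 < / INR b ^ 3) by now apply Rinv_0_lt_compat, pow_lt.
  assert (H8 : 0 < / INR b ^ 8) by now apply Rinv_0_lt_compat, pow_lt.
  apply (Rmult_le_compat_l (/ INR b ^ 3)) in H; [|lra].
  rewrite <- (Rabs_pos_eq (/ INR b ^ 3)), <- Rabs_mult in H at 1 by lra.
  rewrite (Rabs_pos_eq (/ INR b ^ 8)) by lra.
  replace (C * / INR b ^ 8) with (/ INR b ^ 3 * (C * / INR b ^ 5)) by (field; lra).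
  eapply Rle_trans; [right; apply (f_equal Rabs) | exact H].
  field; lra.
Qed.
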